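(* Let $\alpha\in(0,1)$ and let $f$ and $g$ be Laplace-transformable functions. The unique Laplace-transformable solution $f$ to the equation $$ {}^{ABC}D^{\alpha}_{0+}f(t)-\frac{B(\alpha)}{1-\alpha}f(t)=g(t) $$ is $$ f(t)=\frac{\alpha-1}{B(\alpha)}g(t)-\frac{(1-\alpha)^2}{\alpha B(\alpha)}\,{}^{RL}D^{\alpha}_{0+}g(t)-\Big(\frac{(1-\alpha)^2}{\alpha B(\alpha)}\,{}^{RL}I^{1-\alpha}_{0+}g(0)\Big)\delta(t)+\frac{\alpha-1}{\alpha\,\Gamma(1-\alpha)}t^{-\alpha}f(0). $$
   Context: The Mittag-Leffler function is $E_\alpha(x)=\sum_{n=0}^\infty \frac{x^n}{\Gamma(\alpha n+1)}$. $B$ is a fixed normalisation function with real, strictly positive values and $B(0)=B(1)=1$. The ABC fractional derivative is $$ {}^{ABC}D^{\alpha}_{0+}f(t)=\frac{B(\alpha)}{1-\alpha}\int_0^t f'(x)E_\alpha\Big(\frac{-\alpha}{1-\alpha}(t-x)^{\alpha}\Big)\,\mathrm{d}x. $$ The Riemann--Liouville fractional integral is ${}^{RL}I^{\nu}_{0+}f(t)=\frac{1}{\Gamma(\nu)}\int_0^t(t-\tau)^{\nu-1}f(\tau)\,\mathrm{d}\tau$ for $\nu>0$, and the Riemann--Liouville derivative is ${}^{RL}D^{\alpha}_{0+}f(t)=\frac{\mathrm{d}}{\mathrm{d}t}\,{}^{RL}I^{1-\alpha}_{0+}f(t)$ for $0<\alpha<1$. ${}^{RL}I^{1-\alpha}_{0+}g(0)$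 denotes the value of ${}^{RL}I^{1-\alpha}_{0+}g$ at $t=0$ (the lower limit); $\delta$ is the Dirac delta, whose Laplace transform is taken to be $1$. A function is Laplace-transformable if it has a well-defined Laplace transform. *)

(* Defs.v *)
From HB Require Import structures.
From mathcomp Require Import all_boot all_order all_algebra.
From mathcomp Require Import all_classical all_reals all_analysis.

Set Implicit Arguments.
Unset Strict Implicit.
Unset Printing Implicit Defensive.

Import Order.TTheory GRing.Theory Num.Theory.
Import numFieldNormedType.Exports.

Local Open Scope classical_set_scope.
Local Open Scope ring_scope.

Section Functions.
Context {R : realType}.
Implicit Types (f g F B : R -> R) (a b t x nu alpha : R).

Local Notation mu := (@lebesgue_measure R).

Definition Gamma x : R :=
  \int[mu]_(t in `[0, +oo[) (t `^ (x - 1) * expR (- t)).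

Definition mittag_leffler alpha x : R :=
  limn (series (fun n : nat => x ^+ n / Gamma (alpha * n%:R + 1))).

(* Absolute convergence of the Laplace integral at one real point implies it
   at every larger one. *)
Definition laplace_transformable f : Prop :=
  exists s : R, mu.-integrable `[0, +oo[ (fun t => (expR (- (s * t)) * f t)%:E).

(* Local absolute continuity on an interval D, in its Lebesgue form: F is an
   indefinite integral of its (almost everywhere defined) derivative. *)
Definition locally_ac (D : set R) F : Prop :=
  forall a b, D a -> D b -> a <= b ->
    mu.-integrable `[a, b] (fun x => (derive1 F x)%:E) /\
    F b - F a = \int[mu]_(x in `[a, b]) derive1 F x.

Definition abc_kernel alpha t : R :=
  mittag_leffler alpha (- alpha / (1 - alpha) * t `^ alpha).

Definition ABC_derivative B alpha f t : R :=
  B alpha / (1 - alpha) *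
  \int[mu]_(x in `[0, t]) (derive1 f x * abc_kernel alpha (t - x)).

Definition RL_integral nu g t : R :=
  (Gamma nu)^-1 * \int[mu]_(x in `[0, t]) ((t - x) `^ (nu - 1) * g x).

(* The value at the lower limit is the limit from the right: evaluating the
   integral over [0, 0] would give 0 whatever g is. *)
Definition RL_integral_at0 nu g : R := lim (RL_integral nu g t @[t --> 0^'+]).

Definition RL_derivative alpha g : R -> R := derive1 (RL_integral (1 - alpha) g).

(* Under these conditions the limit in RL_integral_at0 (1 - alpha) g exists,
   since the derivative is integrable near 0. *)
Definition RL_differentiable alpha g : Prop :=
  locally_ac `]0, +oo[ (RL_integral (1 - alpha) g) /\
  laplace_transformable (RL_derivative alpha g).

End Functions.

(* Generalized functions supported in [0, +oo[.  Because of this support they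
   act on smooth functions that need only vanish far to the right. *)
Section GeneralizedFunctions.
Context {R : realType}.
Implicit Types (f g h K B phi : R -> R) (alpha m : R).
Implicit Types (T U : (R -> R) -> R).

Local Notation mu := (@lebesgue_measure R).

Definition test_function phi : Prop :=
  (forall (n : nat) (x : R), derivable (derive1n n phi) x 1) /\
  (exists M : R, forall x : R, M <= x -> phi x = 0).

Definition same_distribution T U : Prop :=
  forall phi, test_function phi -> T phi = U phi.

Definition regular_distribution h : (R -> R) -> R :=
  fun phi => \int[mu]_(x in `[0, +oo[) (h x * phi x).

Definition dirac_delta : (R -> R) -> R := fun phi => phi 0.

Definition distribution_derive T : (R -> R) -> R :=
  fun phi => - T (derive1 phi).

(* Convolution of T with K extended by 0 to the negative half-line. *)
Definition distribution_conv K T : (R -> R) -> R :=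
  fun phi => T (fun x => \int[mu]_(y in `[0, +oo[) (K y * phi (x + y))).

Definition laplace_transformable_distribution T : Prop :=
  exists h m, laplace_transformable h /\
    same_distribution T (regular_distribution h + m *: dirac_delta).

(* If f is locally absolutely continuous on [0, +oo[ and extended by 0 to the
   negative half-line, its distributional derivative is f' + f(0) dirac_delta.
   The part of f' in the classical operator is thus played by
   distribution_derive T - f0 *: dirac_delta, where f0 is the initial value of
   T.  For T = regular_distribution f and f0 = f 0 the result is
   regular_distribution (ABC_derivative B alpha f). *)
Definition ABC_distribution_derivative B alpha (f0 : R) T : (R -> R) -> R :=
  (B alpha / (1 - alpha)) *:
  distribution_conv (abc_kernel alpha)
    (distribution_derive T - f0 *: dirac_delta).

Definition abc_solution B alpha g (f0 : R) : (R -> R) -> R :=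
  ((alpha - 1) / B alpha) *: regular_distribution g
  - ((1 - alpha) ^+ 2 / (alpha * B alpha)) *:
      regular_distribution (RL_derivative alpha g)
  - ((1 - alpha) ^+ 2 / (alpha * B alpha) * RL_integral_at0 (1 - alpha) g)
      *: dirac_delta
  + regular_distribution (fun t =>
      (alpha - 1) / (alpha * Gamma (1 - alpha)) * t `^ (- alpha) * f0).

End GeneralizedFunctions.

(* Main.v *)
Require Import Defs.
From HB Require Import structures.
From mathcomp Require Import all_boot all_order all_algebra.
From mathcomp Require Import all_classical all_reals all_analysis.
From mathcomp Require Import measurable_realfun ring lra.

Set Implicit Arguments.
Unset Strict Implicit.
Unset Printing Implicit Defensive.

Import Order.TTheory GRing.Theory Num.Theory.
Import numFieldNormedType.Exports.

Local Open Scope classical_set_scope.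
Local Open Scope ring_scope.

(** Write k for the kernel [abc_kernel alpha], c for alpha / (1 - alpha), h_nu
    for the Riemann-Liouville kernel t ^ (nu - 1) / Gamma nu, * for the
    convolution of functions on the half-line, 1 for the constant function (so
    that 1 * u is the primitive of u vanishing at 0) and G for
    (1 - alpha) / B alpha times g.  Two identities carry the proof:

    - k + c (h_alpha * k) = 1 ([abc_kernel_volterra]), obtained by integrating
      the Mittag-Leffler series term by term;
    - h_alpha * h_(1 - alpha) = 1 ([convolve_RL_kernel]), an instance of the
      beta integral.

    Consider h + m delta with initial value f0, where m = 0 for a function.
    After multiplication by (1 - alpha) / B alpha and one integration, the
    equation says that
      Y = k * h + m k - m - 1 * h - 1 * G - f0 (1 * k)
    vanishes ([abc_defect]).  After multiplication by c and one integration,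
    the formula says that
      Z = c (1 * h) + c m + c (1 * G) + h_(1 - alpha) * G
          + f0 (1 * h_(1 - alpha))
    vanishes ([abc_solution_defect]); the Dirac term of the solution is the
    constant by which the primitive of the Riemann-Liouville derivative of g
    differs from h_(1 - alpha) * g ([RL_integral_primitive]).  The two
    identities give
      h_alpha * k * (1 * Z) = - 1 * (1 * Y)
    ([primitive_defects]).  Convolutions with 1, h_alpha and k are injective,
    by Lebesgue differentiation for 1 and by the two identities for the others,
    so Y vanishes exactly when Z does ([abc_defectP]).  This replaces the usual
    division of Laplace transforms.

    A distribution w + C delta is null on all test functions exactly when
    1 * w + C vanishes on the positive half-line ([pairing_dirac_eq0]): smooth
    bumps increasing to the indicator of ]-oo, b[ detect the value at b.  The
    adjoint of convolution with k acts on test functions by integration against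
    translates ([pairing_smear]), so both the equation and the formula between
    distributions become statements on Y and Z ([distribution_equationP],
    [solution_defectP]).

    For a classical solution f = f 0 + 1 * f', the equation forces
    G = - f 0 - c (h_alpha * (f' * k)), hence
    h_(1 - alpha) * G = - f 0 (1 * h_(1 - alpha)) - c (1 * (f' * k)) is the
    primitive of a function that is continuous on the open half-line.  This is
    why g has a Riemann-Liouville derivative
    ([classical_RL_differentiable]). *)

(** * Lebesgue integrals under affine substitutions *)

Section affine.
Context {R : realType}.
Local Notation mu := (@lebesgue_measure R).

Lemma lebesgue_measure_shift (t : R) (A : set R) : measurable A ->
  pushforward mu (fun x : R => x + t : measurableTypeR R) A = mu A.
Proof.
have m : measurable_fun setT
    (fun x : measurableTypeR R => x + t : measurableTypeR R).
  exact: measurable_funD.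
move=> mA; apply/esym/lebesgue_measure_unique => //= _ [[a b]] _ <-.
rewrite /pushforward.
rewrite (_ : _ @^-1` _ = `]a - t, b - t]%classic); last first.
  by apply/seteqP; split => x /=; rewrite !in_itv/= ltrBlDr lerBrDr.
rewrite !lebesgue_measure_itv/= !lte_fin ltrD2r.
by case: ifP => // _; rewrite -?EFinB; congr EFin; ring.
Qed.

Lemma lebesgue_measure_scale (r : R) (r0 : 0 < r) (A : set R) :
  measurable A ->
  pushforward (mscale (NngNum (ltW r0)) mu)
    (fun x : R => r * x : measurableTypeR R) A = mu A.
Proof.
have m : measurable_fun setT
    (fun x : measurableTypeR R => r * x : measurableTypeR R).
  exact: measurable_funM.
move=> mA; apply/esym/lebesgue_measure_unique => //= _ [[a b]] _ <-.
rewrite /pushforward/= /mscale/=.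
rewrite (_ : _ @^-1` _ = `]a / r, b / r]%classic); last first.
  apply/seteqP; split => x /=; rewrite !in_itv/=;
  by rewrite ltr_pdivrMr// ler_pdivlMr// ![r * _]mulrC.
rewrite !lebesgue_measure_itv/= !lte_fin ltr_pM2r ?invr_gt0//.
case: ifP => _; rewrite -?EFinB -?EFinM ?mulr0 ?mule0//; congr EFin.
by rewrite -mulrBl mulrCA divff ?mulr1// gt_eqF.
Qed.

Lemma ge0_integral_shift (t : R) (F : R -> \bar R) :
  measurable_fun setT F -> (forall x, 0 <= F x)%E ->
  (\int[mu]_x F (x + t)%R = \int[mu]_x F x)%E.
Proof.
move=> mF F0.
have m : measurable_fun setT
    (fun x : measurableTypeR R => x + t : measurableTypeR R).
  exact: measurable_funD.
rewrite -[LHS](@ge0_integral_pushforward _ _ _ _ _ _ m mu setT)//.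
by apply: eq_measure_integral => A mA _; exact: lebesgue_measure_shift.
Qed.

Lemma ge0_integral_scale (r : R) (F : R -> \bar R) : 0 < r ->
  measurable_fun setT F -> (forall x, 0 <= F x)%E ->
  (r%:E * \int[mu]_x F (r * x)%R = \int[mu]_x F x)%E.
Proof.
move=> r0 mF F0.
have m : measurable_fun setT
    (fun x : measurableTypeR R => r * x : measurableTypeR R).
  exact: measurable_funM.
transitivity (\int[mscale (NngNum (ltW r0)) mu]_x F (r * x)%R)%E.
  rewrite ge0_integral_mscale//.
  exact: (measurableT_comp mF m).
rewrite -[LHS](@ge0_integral_pushforward _ _ _ _ _ _ m
  (mscale (NngNum (ltW r0)) mu) setT)//.
by apply: eq_measure_integral => A mA _; exact: lebesgue_measure_scale.
Qed.

Lemma ge0_integral_reflect (t : R) (F : R -> \bar R) :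
  measurable_fun setT F -> (forall x, 0 <= F x)%E ->
  (\int[mu]_x F (t - x)%R = \int[mu]_x F x)%E.
Proof.
move=> mF F0.
have m : measurable_fun setT (-%R : measurableTypeR R -> measurableTypeR R).
  exact: (measurable_funN (@measurable_id _ _ setT)).
have mt : measurable_fun setT
    (fun x : measurableTypeR R => x + t : measurableTypeR R).
  exact: measurable_funD.
under eq_integral do rewrite addrC.
rewrite -(ge0_integral_shift t mF F0).
rewrite -[LHS](@ge0_integral_pushforward _ _ _ _ _ _ m mu setT
   (fun x => F (x + t)%R))//; last exact: (measurableT_comp mF mt).
by apply: eq_measure_integral => A mA _; exact: lebesgue_measureN.
Qed.

Lemma integral_reflect (t : R) (F : R -> \bar R) :
  measurable_fun setT F -> (\int[mu]_x F (t - x)%R = \int[mu]_x F x)%E.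
Proof.
move=> mF; rewrite integralE [RHS]integralE.
have mp := measurable_funepos mF; have mn := measurable_funeneg mF.
by congr (_ - _)%E; rewrite -[RHS](ge0_integral_reflect t)//;
  apply: eq_integral => x _; rewrite ?funeposE ?funenegE.
Qed.

End affine.

(** * Real-valued integrals *)

Section fubini_real.
Context {R : realType}.
Local Notation mu := (@lebesgue_measure R).

Lemma Rintegral_fine d (T : measurableType d) (m : {measure set T -> \bar R})
    (D : set T) (F : T -> \bar R) : measurable D -> m.-integrable D F ->
  m.-integrable D (EFin \o (fine \o F)) /\
  \int[m]_(x in D) fine (F x) = fine (\int[m]_(x in D) F x)%E.
Proof.
move=> mD iF; have [mF _] := integrableP _ _ _ iF.
have mfF : measurable_fun D (EFin \o (fine \o F)).
  by apply/measurable_EFinP; exact: measurableT_comp.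
split; last first.
  congr fine; apply: ae_eq_integral => //.
  have := integrable_ae mD iF; apply: filterS => x FD Dx.
  by rewrite /= fineK// FD.
apply: le_integrable iF => // x Dx /=; case: (F x) => //=;
by rewrite normr0 leey.
Qed.

Lemma integrable_swap (f : R * R -> \bar R) :
  (mu \x mu)%E.-integrable setT f ->
  (mu \x mu)%E.-integrable setT (fun z => f (z.2, z.1)).
Proof.
move=> intf; have [mf _] := integrableP _ _ _ intf.
have mfs : measurable_fun setT (fun z => f (z.2, z.1)).
  apply: (measurableT_comp mf); apply: measurable_fun_pair => /=;
  [exact: measurable_snd|exact: measurable_fst].
apply/(integrable12ltyP mu mu mfs) => /=.
exact/(integrable21ltyP mu mu mf).
Qed.

Lemma Rintegral_fubini (f : R * R -> R) :
  (mu \x mu)%E.-integrable setT (EFin \o f) ->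
  \int[mu]_x (\int[mu]_y f (x, y)) = \int[mu]_y (\int[mu]_x f (x, y)).
Proof.
move=> intf.
have [_ e1] := Rintegral_fine measurableT (integrable_fubini_F intf).
have [_ e2] := Rintegral_fine measurableT
  (integrable_fubini_F (integrable_swap intf)).
rewrite [LHS]e1 [RHS]e2; congr fine; exact: (Fubini intf).
Qed.

(** When the positive or the negative part has infinite integral, so has their
    difference (+oo - +oo being -oo), and [fine] maps it to 0. *)
Lemma Rintegral_nonintegrable d (T : measurableType d)
    (m : {measure set T -> \bar R}) (D : set T) (f : T -> R) :
  measurable D -> measurable_fun D f ->
  ~ m.-integrable D (EFin \o f) -> \int[m]_(x in D) f x = 0.
Proof.
move=> mD mf nint; rewrite /Rintegral integralE.
set p := (\int[m]_(x in D) _)%E; set n := (X in (_ - X)%E).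
have mEf : measurable_fun D (EFin \o f) by exact/measurable_EFinP.
have p0 : (0 <= p)%E by apply: integral_ge0 => x _; exact: funepos_ge0.
have n0 : (0 <= n)%E by apply: integral_ge0 => x _; exact: funeneg_ge0.
have sE : (\int[m]_(x in D) `|(EFin \o f) x| = p + n)%E.
  rewrite /p /n -ge0_integralD//.
  - by apply: eq_integral => x _; rewrite -[LHS]/((abse \o (EFin \o f)) x)
      fune_abse.
  - exact: measurable_funepos.
  - exact: measurable_funeneg.
have : ~ (p + n < +oo)%E.
  by move=> pn; apply: nint; apply/integrableP; split => //; rewrite sE.
by case: p p0 {sE} => [p| |]; case: n n0 => [n| |]//= _ _ /(_ (ltry _)).
Qed.

(** Homogeneity holds without integrability, because the integral of a
    non-integrable measurable function is 0 by convention. *)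
Lemma RintegralZl_measurable d (T : measurableType d)
    (m : {measure set T -> \bar R}) (D : set T) (f : T -> R) (r : R) :
  measurable D -> measurable_fun D f ->
  \int[m]_(x in D) (r * f x) = r * \int[m]_(x in D) f x.
Proof.
move=> mD mf; have [->|r0] := eqVneq r 0.
  rewrite mul0r; under eq_Rintegral do rewrite mul0r.
  by rewrite /Rintegral integral0.
have [intf|nintf] := pselect (m.-integrable D (EFin \o f)).
  by rewrite RintegralZl.
rewrite !Rintegral_nonintegrable ?mulr0//; first exact: measurable_funM.
move=> /(integrableZl mD r^-1) i; apply: nintf.
apply: eq_integrable i => // x _ /=.
by rewrite -EFinM mulKf.
Qed.

Lemma Rintegral_dominated_cvg d (T : measurableType d)
    (m : {measure set T -> \bar R}) (D : set T) (F : (T -> R)^nat)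
    (f g : T -> R) : measurable D -> (forall n, measurable_fun D (F n)) ->
  (forall x, D x -> F n x @[n --> \oo] --> f x) ->
  m.-integrable D (EFin \o g) ->
  (forall n x, D x -> `|F n x| <= g x) ->
  \int[m]_(x in D) F n x @[n --> \oo] --> \int[m]_(x in D) f x.
Proof.
move=> mD mF Ff ig Fg.
have mEF n : measurable_fun D (EFin \o F n) by exact/measurable_EFinP.
have Ef x : D x -> (F n x)%:E @[n --> \oo] --> (f x)%:E.
  by move=> Dx; apply: cvg_EFin; [exact: nearW|exact: Ff].
have mf : measurable_fun D (EFin \o f).
  exact: (emeasurable_fun_cvg (fun n => EFin \o F n) _ mEF Ef).
have [intf _ H] := dominated_convergence mD mEF mf
  (aeW m Ef) ig (aeW m (fun x n Dx => Fg n x Dx)).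
apply: (fine_cvg (a := \int[m]_(x in D) f x)).
by rewrite /Rintegral fineK//; exact: integrable_fin_num.
Qed.

End fubini_real.

(** * Convolution on the half-line *)

Section convolution.
Context {R : realType}.
Implicit Types (a b f q U V : R -> R) (t x T : R).
Local Notation mu := (@lebesgue_measure R).
Local Notation Rpos := (`[0%R, +oo[%classic : set (measurableTypeR R)).

(** The convolution of the extensions of [a] and [b] by 0 to the negative
    half-line ([convolveE]). *)
Definition convolve a b t := \int[mu]_(x in `[0, t]) (a (t - x) * b x).

(** Integrability up to 0 included; abbreviated [li0] in lemma names. *)
Definition locally_integrable0 f :=
  forall T, mu.-integrable `[0, T] (EFin \o f).

(** Measurable and bounded on bounded intervals starting at 0; abbreviated
    [lb0] in lemma names.  Convolution with a locally bounded function has an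
    integrable integrand at every point, so the identities below hold
    everywhere and not merely almost everywhere. *)
Definition locally_bounded0 f := measurable_fun Rpos f /\
  forall T, exists C : R, 0 <= C /\ forall x, 0 <= x <= T -> `|f x| <= C.

Local Notation causal f := (f \_ `[0, +oo[).

Lemma causalE f x : (causal f) x = if 0 <= x then f x else 0.
Proof.
rewrite patchE; case: ifPn => [|].
  by rewrite inE/= in_itv/= andbT => ->.
by rewrite notin_setE/= in_itv/= andbT => /negP/negPf ->.
Qed.

Lemma measurable_causal f :
  measurable_fun Rpos f <-> measurable_fun setT (causal f).
Proof. exact: measurable_restrictT. Qed.

Lemma convolve_mkcond a b t :
  convolve a b t = \int[mu]_x ((fun x => a (t - x) * b x) \_ `[0, t]) x.
Proof. exact: Rintegral_mkcond. Qed.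

Lemma convolveE a b t :
  convolve a b t = \int[mu]_x ((causal a) (t - x) * (causal b) x).
Proof.
rewrite convolve_mkcond; apply: eq_Rintegral => x _.
rewrite patchE !causalE subr_ge0; case: ifPn; rewrite ?inE ?notin_setE/= in_itv/=.
  by move=> /andP[-> ->].
by move=> /negP; rewrite negb_and => /orP[/negPf->|/negPf->]; rewrite ?mul0r ?mulr0.
Qed.

Lemma measurable_reflect t f :
  measurable_fun setT f -> measurable_fun setT (fun x => f (t - x)).
Proof.
move=> mf; apply: (measurableT_comp mf); exact: measurable_funB.
Qed.

Lemma convolveC a b t : measurable_fun Rpos a -> measurable_fun Rpos b ->
  convolve a b t = convolve b a t.
Proof.
move=> /measurable_causal ma /measurable_causal mb; rewrite !convolveE.
rewrite /Rintegral; congr fine.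
rewrite -(integral_reflect t); last first.
  apply/measurable_EFinP; apply: measurable_funM => //.
  exact: measurable_reflect.
by apply: eq_integral => x _; rewrite subKr mulrC.
Qed.

Lemma integrable_reflect t U : mu.-integrable setT (EFin \o U) ->
  mu.-integrable setT (EFin \o (fun x => U (t - x))).
Proof.
move=> /integrableP[/measurable_EFinP mU iU]; apply/integrableP; split.
  by apply/measurable_EFinP; exact: measurable_reflect.
rewrite (ge0_integral_reflect t (F := fun x => `|(U x)%:E|%E))//.
by apply/measurable_EFinP; exact: measurableT_comp.
Qed.

Lemma measurable_sub_pair U : measurable_fun setT U ->
  measurable_fun setT (fun z : R * R => U (z.1 - z.2)).
Proof.
move=> mU; apply: (measurableT_comp mU); apply: measurable_funB.
  exact: measurable_fst.
exact: measurable_snd.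
Qed.

Lemma integrable_mul_sub U V : mu.-integrable setT (EFin \o U) ->
  mu.-integrable setT (EFin \o V) ->
  (mu \x mu)%E.-integrable setT
    (EFin \o (fun z : R * R => U z.1 * V (z.1 - z.2))).
Proof.
move=> /[dup] iU /integrableP[/measurable_EFinP mU fU].
move=> /[dup] iV /integrableP[/measurable_EFinP mV fV].
have mUV : measurable_fun setT
    (EFin \o (fun z : R * R => U z.1 * V (z.1 - z.2))).
  apply/measurable_EFinP/measurable_funM; last exact: measurable_sub_pair.
  by apply: (measurableT_comp mU); exact: measurable_fst.
have mnV : measurable_fun setT (fun x => `|(V x)%:E|%E).
  by apply/measurable_EFinP; exact: measurableT_comp.
have mnU : measurable_fun setT (fun x => `|(U x)%:E|%E).
  by apply/measurable_EFinP; exact: measurableT_comp.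
apply/(integrable12ltyP mu mu mUV) => /=.
have inner x : (\int[mu]_y (`|U x * V (x - y)|%R)%:E =
    `|(U x)%:E| * \int[mu]_y `|(V y)%:E|)%E.
  under eq_integral do rewrite normrM EFinM.
  rewrite ge0_integralZl//.
    by rewrite (ge0_integral_reflect x (F := fun x => `|(V x)%:E|%E)).
  by apply/measurable_EFinP/measurableT_comp => //; exact: measurable_reflect.
under eq_integral do rewrite inner.
rewrite ge0_integralZr//; last exact: integral_ge0.
by rewrite lte_mul_pinfty//; [exact: integral_ge0|
  rewrite ge0_fin_numE//; exact: integral_ge0].
Qed.

Local Notation trunc T f := (f \_ `[0, T]).

Lemma truncE T f x : (trunc T f) x = if 0 <= x <= T then f x else 0.
Proof.
rewrite patchE; case: ifPn => [|].
  by rewrite inE/= in_itv/= => ->.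
by rewrite notin_setE/= in_itv/= => /negP/negPf ->.
Qed.

Lemma li0_measurable f : locally_integrable0 f -> measurable_fun Rpos f.
Proof.
move=> lf; rewrite itv0y_bigcup0S; apply/measurable_fun_bigcup => // n.
by have /integrableP[/measurable_EFinP] := lf n.+1%:R.
Qed.

Lemma integrable_trunc T f : locally_integrable0 f ->
  mu.-integrable setT (EFin \o trunc T f).
Proof.
by move=> /(_ T) /integrable_mkcond; rewrite restrict_EFin; exact.
Qed.

(** Up to time [T] the factors can be replaced by integrable functions on the
    whole line, to which Fubini's theorem applies. *)
Lemma convolve_trunc a b t T : t <= T ->
  convolve a b t = \int[mu]_x ((trunc T a) (t - x) * (trunc T b) x).
Proof.
move=> tT; rewrite convolveE; apply: eq_Rintegral => x _.
rewrite !causalE !truncE.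
have [x0|x0] := leP 0 x; last by rewrite !mulr0.
have [xt|xt] := leP 0 (t - x); last by rewrite !mul0r.
have xT : x <= T by move: xt; rewrite subr_ge0 => /le_trans; exact.
by rewrite xT/= (_ : t - x <= T)//; lra.
Qed.

Lemma convolve_lt0 a b t : t < 0 -> convolve a b t = 0.
Proof.
by move=> t0; rewrite /convolve set_itv_ge ?Rintegral_set0//= bnd_simp -ltNge.
Qed.

(** The convolution of two integrable functions is an inner integral of the
    function integrated by Fubini's theorem on the plane. *)
Lemma li0_convolve a b : locally_integrable0 a -> locally_integrable0 b ->
  locally_integrable0 (convolve a b).
Proof.
move=> la lb T; set A := trunc T a; set B := trunc T b.
have iA : mu.-integrable setT (EFin \o A) by exact: integrable_trunc.
have iB : mu.-integrable setT (EFin \o B) by exact: integrable_trunc.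
have /integrable_swap/integrable_fubini_F := integrable_mul_sub iB
  (integrable_reflect 0 iA).
move=> /(Rintegral_fine measurableT)[i _].
move: i; set F := fine \o _ => i.
have {}i : mu.-integrable `[0, T] (EFin \o F) by apply: integrableS i.
apply: eq_integrable i => // t; rewrite inE/= in_itv/= => /andP[t0 tT].
congr EFin; rewrite (convolve_trunc _ _ tT).
apply: eq_Rintegral => x _ /=.
by rewrite mulrC sub0r opprB.
Qed.

Lemma lb0_measurable f : locally_bounded0 f -> measurable_fun Rpos f.
Proof. by case. Qed.

Lemma measurable_Rpos_itv T f : measurable_fun Rpos f ->
  measurable_fun (`[0, T]%classic : set (measurableTypeR R)) f.
Proof. by apply: measurable_funS => //; apply: subset_itvl. Qed.

Lemma li0_mul_lb0 f q : locally_integrable0 f -> locally_bounded0 q ->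
  locally_integrable0 (fun x => f x * q x).
Proof.
move=> lf [mq bq] T; have [C [C0 qC]] := bq T.
have : mu.-integrable `[0, T] (fun x => C%:E * (f x)%:E)%E.
  by apply: integrableZl => //; exact: lf.
apply: le_integrable => //.
  apply/measurable_EFinP; apply: measurable_funM; last first.
    exact: measurable_Rpos_itv.
  by have /integrableP[/measurable_EFinP] := lf T.
move=> x /=; rewrite in_itv/= => /qC qx.
by rewrite lee_fin !normrM mulrC ler_wpM2r// (ger0_norm C0).
Qed.

Lemma lb0_li0 q : locally_bounded0 q -> locally_integrable0 q.
Proof.
move=> [mq bq] T; apply: measurable_bounded_integrable => //=.
- have [T0|T0] := leP 0 T.
    by rewrite lebesgue_measure_itv/=; case: ifPn => // _; rewrite -EFinB ltry.
  by rewrite set_itv_ge ?measure0// bnd_simp -ltNge.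
- exact: measurable_Rpos_itv.
have [C [C0 qC]] := bq T.
exists C; split; first exact: num_real.
move=> M CM x /=; rewrite in_itv/= => /qC qx.
by rewrite (le_trans qx)// ltW.
Qed.

(** Fubini's theorem for A (t - z) B (z - y) Q y, which is integrable on the
    plane because the third factor is bounded. *)
Lemma convolveA a b q t : locally_integrable0 a -> locally_integrable0 b ->
  locally_bounded0 q -> convolve a (convolve b q) t = convolve (convolve a b) q t.
Proof.
move=> la lb lq; have [t0|t0] := ltP t 0; first by rewrite !convolve_lt0.
have lq' := lb0_li0 lq.
set A := trunc t a; set B := trunc t b; set Q := trunc t q.
have iA : mu.-integrable setT (EFin \o A) by exact: integrable_trunc.
have iB : mu.-integrable setT (EFin \o B) by exact: integrable_trunc.
have iQ : mu.-integrable setT (EFin \o Q) by exact: integrable_trunc.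
have /integrableP[/measurable_EFinP mA _] := iA.
have /integrableP[/measurable_EFinP mB _] := iB.
have /integrableP[/measurable_EFinP mQ _] := iQ.
have mAB := integrable_mul_sub (integrable_reflect t iA) iB.
have /integrableP[/measurable_EFinP mABm _] := mAB.
pose Phi := fun z : R * R => A (t - z.1) * B (z.1 - z.2) * Q z.2.
have iPhi : (mu \x mu)%E.-integrable setT (EFin \o Phi).
  have [C [C0 qC]] := lq.2 t.
  have : (mu \x mu)%E.-integrable setT
      (fun z : R * R => C%:E * (A (t - z.1) * B (z.1 - z.2))%:E)%E.
    by apply: integrableZl => //; exact: mAB.
  apply: le_integrable => //.
    apply/measurable_EFinP; apply: measurable_funM; first exact: mABm.
    by apply: (measurableT_comp mQ); exact: measurable_snd.
  move=> [z y] _ /=; rewrite lee_fin /Phi/= !normrM (ger0_norm C0).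
  rewrite [leRHS]mulrC ler_wpM2l// ?mulr_ge0// /Q truncE.
  by case: ifPn => [/qC//|_]; rewrite normr0.
have := Rintegral_fubini iPhi.
rewrite (_ : \int[mu]_x _ = convolve a (convolve b q) t); last first.
  rewrite [RHS]convolve_mkcond; apply: eq_Rintegral => z _ /=.
  transitivity (A (t - z) * \int[mu]_y (B (z - y) * Q y)).
    rewrite -RintegralZl_measurable//; last first.
      apply: measurable_funM => //; exact: measurable_reflect.
    by apply: eq_Rintegral => y _; rewrite /Phi/= mulrA.
  rewrite truncE /A truncE subr_ge0 lerBlDr lerDl andbC.
  by case: ifPn => [/andP[z0 zt]|_]; rewrite ?mul0r// -(convolve_trunc _ _ zt).
move=> ->.
rewrite [RHS]convolve_mkcond; apply: eq_Rintegral => y _ /=.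
transitivity (Q y * \int[mu]_z (A (t - z) * B (z - y))).
  rewrite -RintegralZl_measurable//; last first.
    apply: measurable_funM => //; first exact: measurable_reflect.
    by apply: (measurableT_comp mB); exact: measurable_funB.
  by apply: eq_Rintegral => z _; rewrite /Phi/= mulrC.
rewrite truncE /Q truncE.
case: ifPn => [/andP[y0 yt]|_]; rewrite ?mul0r// mulrC; congr (_ * _).
rewrite convolveC; [|exact: li0_measurable..].
rewrite (@convolve_trunc _ _ _ t); last by rewrite lerBlDr lerDl.
rewrite /Rintegral; congr fine.
rewrite -(integral_reflect t); last first.
  apply/measurable_EFinP; apply: measurable_funM; first exact: measurable_reflect.
  by apply: (measurableT_comp mB); exact: measurable_funB.
by apply: eq_integral => z _; rewrite subKr mulrC addrAC.
Qed.

End convolution.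

(** * Linearity and congruence of convolution *)

Section convolution_theory.
Context {R : realType}.
Implicit Types (a b f q r : R -> R) (t x T c : R).
Local Notation mu := (@lebesgue_measure R).
Local Notation Rpos := (`[0%R, +oo[%classic : set (measurableTypeR R)).
Local Notation trunc T f := (f \_ `[0, T]).

Lemma integrable_convolve a q t : locally_integrable0 a -> locally_bounded0 q ->
  mu.-integrable `[0, t] (EFin \o (fun x => a (t - x) * q x)).
Proof.
move=> la lq.
have i1 : mu.-integrable setT (EFin \o (fun x => trunc t a (t - x))).
  by apply: integrable_reflect; exact: integrable_trunc.
have [C [C0 qC]] := lq.2 t.
have : mu.-integrable `[0, t] (fun x => C%:E * (trunc t a (t - x))%:E)%E.
  apply: integrableZl => //.
  by apply: integrableS i1.
have /integrableP[/measurable_EFinP m1 _] := i1.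
apply: le_integrable => //.
  apply/measurable_EFinP; apply: measurable_funM; last first.
    by apply: measurable_Rpos_itv; exact: lq.1.
  apply: eq_measurable_fun (measurable_funTS m1) => x.
  rewrite inE/= in_itv/= => /andP[x0 xt].
  by rewrite truncE subr_ge0 xt lerBlDr lerDl x0.
move=> x /=; rewrite in_itv/= => /andP[x0 xt].
rewrite truncE subr_ge0 xt lerBlDr lerDl x0/= lee_fin !normrM mulrC.
by rewrite ler_wpM2r// (ger0_norm C0) qC// x0.
Qed.

Lemma convolve_eqr a q r t : (forall x, 0 <= x <= t -> q x = r x) ->
  convolve a q t = convolve a r t.
Proof.
move=> qr; apply: eq_Rintegral => x; rewrite inE/= in_itv/= => xt.
by rewrite qr.
Qed.

Lemma convolve_eql a b q t : (forall x, 0 <= x <= t -> a x = b x) ->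
  convolve a q t = convolve b q t.
Proof.
move=> ab; apply: eq_Rintegral => x; rewrite inE/= in_itv/= => /andP[x0 xt].
by rewrite ab// subr_ge0 xt lerBlDr lerDl.
Qed.

Lemma convolve_eq0 f q t : (forall x, 0 <= x -> q x = 0) ->
  convolve f q t = 0.
Proof.
move=> q0; transitivity (\int[mu]_(x in `[0, t]) (0 : R)).
  apply: eq_Rintegral => x; rewrite inE/= in_itv/= => /andP[x0 _].
  by rewrite q0// mulr0.
by rewrite /Rintegral integral0.
Qed.

Lemma convolveDr a q r t : locally_integrable0 a ->
  locally_bounded0 q -> locally_bounded0 r ->
  convolve a (q \+ r) t = convolve a q t + convolve a r t.
Proof.
move=> la lq lr; rewrite /convolve -RintegralD//; [|exact: integrable_convolve..].
by apply: eq_Rintegral => x _; rewrite mulrDr.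
Qed.

Lemma convolveDl (u v q : R -> R) t : locally_integrable0 u ->
  locally_integrable0 v -> locally_bounded0 q ->
  convolve (u \+ v) q t = convolve u q t + convolve v q t.
Proof.
move=> lu lv lq; rewrite /convolve -RintegralD//; [|exact: integrable_convolve..].
by apply: eq_Rintegral => x _; rewrite mulrDl.
Qed.

Lemma measurable_convolve a b t :
  measurable_fun Rpos a -> measurable_fun Rpos b ->
  measurable_fun (`[0, t]%classic : set (measurableTypeR R))
    (fun x => a (t - x) * b x).
Proof.
move=> ma mb; apply: measurable_funM; last exact: measurable_Rpos_itv.
apply: (measurable_comp (F := Rpos)) => //.
- move=> _ [x /=] + <-; rewrite !in_itv/= => /andP[_ xt].
  by rewrite subr_ge0 xt.
- exact: measurable_funB.
Qed.

Lemma convolveZr a q c t : measurable_fun Rpos a -> measurable_fun Rpos q ->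
  convolve a (fun x => c * q x) t = c * convolve a q t.
Proof.
move=> ma mq; rewrite /convolve -RintegralZl_measurable//; last first.
  exact: measurable_convolve.
by apply: eq_Rintegral => x _; rewrite mulrCA.
Qed.

Lemma ae_mono (P Q : R -> Prop) : (forall x, P x -> Q x) ->
  {ae mu, forall x, P x} -> {ae mu, forall x, Q x}.
Proof. by move=> PQ; apply: (@filterS _ _ (ae_filter_ringOfSetsType mu)). Qed.

Lemma ae_mono2 (P Q S : R -> Prop) : (forall x, P x -> Q x -> S x) ->
  {ae mu, forall x, P x} -> {ae mu, forall x, Q x} -> {ae mu, forall x, S x}.
Proof. by move=> PQ; apply: (@filterS2 _ _ (ae_filter_ringOfSetsType mu)). Qed.

Lemma ae_neq0 : {ae mu, forall x, x != 0}.
Proof.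
exists [set 0]; split; first exact: measurable_set1.
  exact: lebesgue_measure_set1.
by move=> x /= /negP; rewrite negbK => /eqP.
Qed.

Lemma convolve_ae a b f t : measurable_fun Rpos a -> measurable_fun Rpos b ->
  measurable_fun Rpos f -> {ae mu, forall x, 0 < x -> b x = f x} ->
  convolve a b t = convolve a f t.
Proof.
move=> ma mb mf bf; rewrite /convolve /Rintegral; congr fine.
apply: ae_eq_integral => //.
- by apply/measurable_EFinP; exact: measurable_convolve.
- by apply/measurable_EFinP; exact: measurable_convolve.
apply: ae_mono2 bf ae_neq0 => x bf x0 /=; rewrite in_itv/= => /andP[x0' _].
by rewrite bf// lt_neqAle eq_sym x0.
Qed.

Lemma lb0_cst c : locally_bounded0 (fun=> c).
Proof.
split; first exact: measurable_cst.
by move=> T; exists `|c|; split.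
Qed.

Lemma lb0D q r : locally_bounded0 q -> locally_bounded0 r ->
  locally_bounded0 (q \+ r).
Proof.
move=> [mq bq] [mr br]; split; first exact: measurable_funD.
move=> T; have [C [C0 qC]] := bq T; have [D [D0 rD]] := br T.
exists (C + D); split; first exact: addr_ge0.
by move=> x xT; rewrite (le_trans (ler_normD _ _))// lerD ?qC ?rD.
Qed.

Lemma lb0Z c q : locally_bounded0 q -> locally_bounded0 (fun x => c * q x).
Proof.
move=> [mq bq]; split; first exact: measurable_funM.
move=> T; have [C [C0 qC]] := bq T.
exists (`|c| * C); split; first exact: mulr_ge0.
by move=> x xT; rewrite normrM ler_wpM2l ?qC.
Qed.

Lemma li0D a b : locally_integrable0 a -> locally_integrable0 b ->
  locally_integrable0 (a \+ b).
Proof. by move=> la lb T; exact: (integrableD _ (la T) (lb T)). Qed.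

Lemma li0Z c a : locally_integrable0 a -> locally_integrable0 (fun x => c * a x).
Proof. by move=> la T; exact: (integrableZl _ c (la T)). Qed.

Lemma convolve1 f t : convolve (fun=> 1) f t = \int[mu]_(x in `[0, t]) f x.
Proof. by apply: eq_Rintegral => x _; rewrite mul1r. Qed.

(** The convolution is bounded on [0, T] by the product of the bound of [q]
    with the integral of the absolute value of [a]. *)
Lemma lb0_convolve a q : locally_integrable0 a -> locally_bounded0 q ->
  locally_bounded0 (convolve a q).
Proof.
move=> la lq; split.
  by apply: li0_measurable; apply: li0_convolve => //; exact: lb0_li0.
have la' : locally_integrable0 (fun x => `|a x|).
  by move=> T; have /integrable_norm := la T.
move=> T; have [C [C0 qC]] := lq.2 T.
exists (C * \int[mu]_(x in `[0, T]) `|a x|); split.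
  by rewrite mulr_ge0// Rintegral_ge0.
move=> t /andP[t0 tT].
rewrite (le_trans (le_normr_Rintegral _ (integrable_convolve t la lq)))//.
apply: (@le_trans _ _ (\int[mu]_(x in `[0, t]) (C * `|a (t - x)|))).
  apply: le_Rintegral => //.
  - by have /integrable_norm := integrable_convolve t la lq.
  - have := integrable_convolve t la' (lb0_cst C).
    by under [X in _ -> integrable _ _ X]eq_fun do rewrite /= mulrC.
  - move=> x /=; rewrite in_itv/= => /andP[x0 xt].
    by rewrite normrM mulrC ler_wpM2r// qC// x0 (le_trans xt).
have -> : \int[mu]_(x in `[0, t]) (C * `|a (t - x)|) =
    convolve (fun x => `|a x|) (fun=> C) t.
  by apply: eq_Rintegral => x _; rewrite mulrC.
rewrite (_ : (fun=> C) = (fun x => C * (fun=> 1) x)); last first.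
  by apply/funext => x; rewrite mulr1.
rewrite convolveZr//; last exact: li0_measurable.
rewrite ler_wpM2l// convolveC//; last exact: li0_measurable.
rewrite convolve1 /Rintegral fine_le//.
- by apply: integrable_fin_num => //; exact: la'.
- by apply: integrable_fin_num => //; exact: la'.
apply: ge0_subset_integral => //=.
- have /integrableP[] := la' T; exact.
- by apply: subset_itvl; rewrite bnd_simp.
Qed.

End convolution_theory.

(** * Injectivity of integration *)

Section primitive.
Context {R : realType}.
Implicit Types (a b f q r : R -> R) (t x T c : R).
Local Notation mu := (@lebesgue_measure R).
Local Notation Rpos := (`[0%R, +oo[%classic : set (measurableTypeR R)).
Local Notation primitive := (convolve (fun=> 1)).

Lemma convolveCA a b q t : locally_integrable0 a -> locally_integrable0 b ->
  locally_bounded0 q ->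
  convolve a (convolve b q) t = convolve b (convolve a q) t.
Proof.
move=> la lb lq; rewrite (convolveA t la lb lq) (convolveA t lb la lq).
by apply: convolve_eql => x _; apply: convolveC; exact: li0_measurable.
Qed.

Lemma primitive_continuous f t : locally_integrable0 f -> 0 < t ->
  {for t, continuous (primitive f)}.
Proof.
move=> lf t0; have t1 : 0 <= t + 1 by rewrite addr_ge0// ltW.
have := parameterized_integral_continuous t1 (lf _).
rewrite (_ : parameterized_integral _ _ ^~ _ = primitive f); last first.
  by apply/funext => x; rewrite convolve1.
move=> /(continuous_within_itvP _ (ltr_wpDl (ltW t0) ltr01))[+ _ _].
by apply; rewrite in_itv/= t0/= ltrDl.
Qed.

Lemma primitive_derive1 f t : locally_integrable0 f -> 0 < t ->
  {for t, continuous f} ->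
  derivable (primitive f) t 1 /\ derive1 (primitive f) t = f t.
Proof.
move=> lf t0 ft.
have -> : primitive f = fun x => \int[mu]_(y in `[0, x]) f y.
  by apply/funext => x; rewrite convolve1.
by apply: (@continuous_FTC1_closed _ f 0 t (t + 1)) => //; rewrite ltrDl.
Qed.

Lemma near_eq_derive1 f g t : (\forall x \near t, f x = g x) ->
  derive1 f t = derive1 g t.
Proof. by move=> fg; rewrite !derive1E; exact: near_eq_derive. Qed.

(** A continuous function is the derivative of its primitive. *)
Lemma primitive_inj_continuous f t : locally_integrable0 f ->
  {for t, continuous f} -> (forall s, 0 < s -> primitive f s = 0) ->
  0 < t -> f t = 0.
Proof.
move=> lf ft f0 t0; have [_ <-] := primitive_derive1 lf t0 ft.
rewrite (near_eq_derive1 (g := fun=> 0)); first by rewrite derive1_cst.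
near=> x; apply: f0; near: x; exact: lt_nbhsr.
Unshelve. all: by end_near. Qed.

(** A primitive is continuous on the open half-line, so
    [primitive_inj_continuous] applies to it. *)
Lemma primitive_inj2 f : locally_integrable0 f ->
  (forall t, 0 < t -> primitive (primitive f) t = 0) ->
  forall t, 0 < t -> primitive f t = 0.
Proof.
move=> lf f0 t t0; apply: (primitive_inj_continuous _ _ f0) => //.
  by apply: li0_convolve => //; exact/lb0_li0/lb0_cst.
exact: primitive_continuous.
Qed.

(** By Lebesgue differentiation, a locally integrable function is almost
    everywhere the derivative of its primitive. *)
Lemma primitive_inj f : locally_integrable0 f ->
  (forall t, 0 < t -> primitive f t = 0) ->
  {ae mu, forall x, 0 < x -> f x = 0}.
Proof.
move=> lf f0.
have H (n : nat) : {ae mu, forall x, 0 < x < n%:R -> f x = 0}.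
  have iT : mu.-integrable setT (EFin \o (f \_ `[0, n%:R])).
    exact: integrable_trunc.
  have iloc := integrable_locally (measurable_itv `[0, n%:R]) (lf n%:R).
  have iy y : mu.-integrable [set` Interval (BLeft 0) (BRight y)]
      (EFin \o (f \_ `[0, n%:R])).
    by apply: integrableS iT.
  apply: ae_mono (FTC1 iy iloc) => x + /andP[x0 xn].
  case; first by rewrite lte_fin.
  move=> _.
  rewrite truncE (ltW x0) (ltW xn)/= => <-.
  rewrite (near_eq_derive1 (g := fun=> 0)); first by rewrite derive1_cst.
  near=> y.
  have yx : 0 < y < n%:R.
    by apply/andP; split; near: y; [exact: lt_nbhsr|exact: lt_nbhsl].
  transitivity (primitive f y); last by apply: f0; case/andP: yx.
  rewrite convolve1.
  apply: eq_Rintegral => z; rewrite inE/= in_itv/= => /andP[z0 zy].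
  by rewrite truncE z0 (le_trans zy)//; case/andP: yx => _ /ltW.
have : {ae mu, forall x (n : nat), 0 < x < n%:R -> f x = 0}.
  by apply: ae_foralln => n; exact: H.
apply: ae_mono => x + x0 => /(_ (Num.truncn x).+1); apply.
by rewrite x0/= truncnS_gt.
Unshelve. all: by end_near. Qed.

End primitive.

(** * Integrable powers *)

Section power.
Context {R : realType}.
Implicit Types (t x T nu : R).
Local Notation mu := (@lebesgue_measure R).
Local Notation Rpos := (`[0%R, +oo[%classic : set (measurableTypeR R)).

Lemma continuous_powR nu x : 0 < x -> {for x, continuous (fun y : R => y `^ nu)}.
Proof.
move=> x0; apply: differentiable_continuous; apply/derivable1_diffP.
by apply: derivable_powR; rewrite in_itv/= x0.
Qed.

Lemma integral_powR_itv nu e T : 0 < nu -> 0 < e -> e < T ->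
  (\int[mu]_(x in `[e, T]) (x `^ (nu - 1))%:E =
   (nu^-1 * (T `^ nu - e `^ nu))%:E)%E.
Proof.
move=> nu0 e0 eT.
have pos x : e <= x -> 0 < x by exact: lt_le_trans.
have dF x : 0 < x -> derivable (fun x => nu^-1 * x `^ nu) x 1.
  move=> x0; apply: derivableZ.
  by apply: derivable_powR; rewrite in_itv/= x0.
have cF x : 0 < x -> {for x, continuous (fun x => nu^-1 * x `^ nu)}.
  by move=> x0; apply: differentiable_continuous; apply/derivable1_diffP/dF.
rewrite (@continuous_FTC2 _ _ (fun x => nu^-1 * x `^ nu))//.
- by rewrite -EFinB mulrBr.
- apply: continuous_in_subspaceT => x; rewrite inE/= in_itv/= => /andP[ex _].
  exact/continuous_powR/pos.
- split.
  + by move=> x; rewrite in_itv/= => /andP[/ltW/pos x0 _]; exact: dF.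
  + by apply: cvg_at_right_filter; exact: cF.
  + by apply: cvg_at_left_filter; apply: cF; exact: lt_trans eT.
- move=> x; rewrite in_itv/= => /andP[/ltW/pos x0 _].
  rewrite derive1E deriveZ/=; last first.
    by apply: derivable_powR; rewrite in_itv/= x0.
  rewrite -derive1E powR_derive1 ?in_itv/= ?x0//.
  by rewrite /GRing.scale/= mulrA mulVf ?mul1r// gt_eqF.
Qed.

(** Monotone convergence along the intervals [1/n, T], on which the power has
    an explicit primitive. *)
Lemma li0_powR nu : 0 < nu -> locally_integrable0 (fun t => t `^ (nu - 1)).
Proof.
move=> nu0 T'; pose T := Num.max T' 2.
suff : mu.-integrable `[0, T] (EFin \o (fun t => t `^ (nu - 1))).
  apply: integrableS => //; apply: subset_itvl; rewrite bnd_simp.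
  by rewrite le_max lexx.
have T1 : 1 < T by rewrite lt_max; apply/orP; right; lra.
have m D : measurable_fun (D : set (measurableTypeR R))
    (EFin \o (fun t => t `^ (nu - 1))).
  by apply/measurable_EFinP; apply: measurable_funTS; exact: measurable_powR.
apply/integrableP; split; first exact: m.
under eq_integral do rewrite /= ger0_norm ?powR_ge0//.
rewrite -integral_itv_obnd_cbnd; last exact: m.
pose F (n : nat) := (`[(n.+1%:R)^-1, T]%classic : set (measurableTypeR R)).
have -> : (`]0, T]%classic : set (measurableTypeR R)) = \bigcup_n F n.
  apply/seteqP; split => x /=; rewrite /F.
    rewrite in_itv/= => /andP[x0 xT].
    exists (Num.truncn x^-1) => //=; rewrite in_itv/= xT andbT.
    by rewrite invf_ple ?posrE//; apply/ltW/truncnS_gt.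
  case=> n _ /=; rewrite !in_itv/= => /andP[nx ->]; rewrite andbT.
  exact: lt_le_trans nx.
have ndF : {homo F : n m / (n <= m)%N >-> (n <= m)%O}.
  move=> n k nk; apply/subsetPset; apply: subset_itvr.
  by rewrite bnd_simp lef_pV2 ?posrE// ler_nat.
have := @ge0_nondecreasing_set_cvg_integral _ _ _ F
  (EFin \o (fun t => t `^ (nu - 1))) mu ndF.
move=> /(_ (fun=> measurable_itv _) (fun n => m (F n))) H.
have {}H := H (fun n x _ => powR_ge0 _ _).
rewrite -(cvg_lim _ H)//.
apply: (@le_lt_trans _ _ (nu^-1 * T `^ nu)%:E); last exact: ltry.
apply: lime_le; first by apply/cvg_ex; eexists; exact: H.
near=> n; rewrite /F integral_powR_itv//.
- by rewrite lee_fin ler_wpM2l//; [rewrite invr_ge0 ltW|rewrite gerBl powR_ge0].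
- by apply: le_lt_trans T1; rewrite invf_le1// ler1n.
Unshelve. all: by end_near. Qed.

End power.

(** * The Gamma function *)

Section gamma.
Context {R : realType}.
Implicit Types (s t x y : R).
Local Notation mu := (@lebesgue_measure R).
Local Notation Rpos := (`[0%R, +oo[%classic : set (measurableTypeR R)).

Lemma exponential_pdfZ s :
  exponential_pdf s = (fun t => s * expR (- (s * t))) \_ `[0, +oo[.
Proof. by congr patch; apply/funext => t; rewrite mulNr. Qed.

Lemma integrable_expRN s : 0 < s ->
  mu.-integrable `[0, +oo[ (EFin \o (fun t => expR (- (s * t)))).
Proof.
move=> s0; have := integrable_exponential_pdf s0.
rewrite exponential_pdfZ -restrict_EFin => i.
have {}i : mu.-integrable `[0, +oo[ (EFin \o (fun t => s * expR (- (s * t)))).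
  by apply/integrable_mkcond.
have {}i : mu.-integrable `[0, +oo[
    (EFin \o (fun t => s^-1 * (s * expR (- (s * t))))).
  exact: (integrableZl _ s^-1 i).
apply: eq_integrable i => // t _.
by rewrite /= mulKf ?gt_eqF.
Qed.

(** The integrand of [Gamma]. *)
Definition gamma_density x t := t `^ (x - 1) * expR (- t).

Lemma gamma_density_ge0 x t : 0 <= gamma_density x t.
Proof. by rewrite mulr_ge0 ?powR_ge0 ?expR_ge0. Qed.

Lemma measurable_expRN : measurable_fun [set: R] (fun t => expR (- t)).
Proof.
apply: measurableT_comp; first exact: measurable_expR.
exact: (measurable_funN (@measurable_id _ _ setT)).
Qed.

Lemma measurable_gamma_density x : measurable_fun [set: R] (gamma_density x).
Proof.
by apply: measurable_funM; [exact: measurable_powR|exact: measurable_expRN].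
Qed.

Lemma powR_le_expR (n : nat) y t : 1 <= t -> y <= n.+1%:R ->
  t `^ y <= 2 ^+ n.+1 * n.+1`!%:R * expR (2^-1 * t).
Proof.
move=> t1 yn; have t0 : 0 <= t by rewrite (le_trans ler01).
rewrite (le_trans (ler_powR t1 yn))// powR_mulrn//.
have h0 : 0 <= 2^-1 * t by rewrite mulr_ge0.
have := expR_ge1Dxn n h0.
set f := n.+1`!%:R => H.
have f0 : 0 < f by rewrite ltr0n fact_gt0.
have {}H : (2^-1 * t) ^+ n.+1 / f <= expR (2^-1 * t).
  by apply: le_trans H; rewrite lerDr.
have -> : t ^+ n.+1 = 2 ^+ n.+1 * (2^-1 * t) ^+ n.+1.
  by rewrite -exprMn mulVKf.
by rewrite -mulrA ler_wpM2l ?exprn_ge0// [leRHS]mulrC -ler_pdivrMr.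
Qed.

(** The density is at most t ^ (x - 1) on [0, 1] and at most a multiple of
    e ^ (- t / 2) beyond 1. *)
Lemma integrable_gamma_density x : 0 < x ->
  mu.-integrable `[0, +oo[ (EFin \o gamma_density x).
Proof.
move=> x0; pose n := Num.truncn x.
pose C := 2 ^+ n.+1 * n.+1`!%:R : R.
have C0 : 0 <= C by rewrite mulr_ge0 ?exprn_ge0.
pose p := (fun t => t `^ (x - 1)) \_ `[0, 1].
pose e t := C * expR (- (2^-1 * t)).
have ip : mu.-integrable `[0, +oo[ (EFin \o p).
  have : mu.-integrable setT (EFin \o p).
    by apply: integrable_trunc; exact: li0_powR.
  exact: integrableS.
have ie : mu.-integrable `[0, +oo[ (EFin \o e).
  have h0 : 0 < (2^-1 : R) by rewrite invr_gt0.
  exact: (integrableZl _ C (integrable_expRN h0)).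
have : mu.-integrable `[0, +oo[ (EFin \o (p \+ e)).
  exact: (integrableD _ ip ie).
apply: le_integrable => //.
  by apply/measurable_EFinP; apply: measurable_funTS;
    exact: measurable_gamma_density.
move=> t /=; rewrite in_itv/= andbT => t0.
have p0 : 0 <= p t by rewrite /p truncE; case: ifP; rewrite ?powR_ge0.
have e0 : 0 <= e t by rewrite mulr_ge0 ?expR_ge0.
rewrite lee_fin (ger0_norm (gamma_density_ge0 _ _)) ger0_norm ?addr_ge0//.
have [t1|t1] := leP t 1.
  apply: (@le_trans _ _ (p t)); last by rewrite lerDl.
  rewrite /p truncE t0 t1/= ler_piMr ?powR_ge0//.
  by rewrite expR_le1 oppr_le0.
apply: (@le_trans _ _ (e t)); last by rewrite lerDr.
have : t `^ (x - 1) <= C * expR (2^-1 * t).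
  apply: powR_le_expR; first exact: ltW.
  by have := truncnS_gt x; rewrite -/n => xn; lra.
move=> /(ler_wpM2r (expR_ge0 (- t)))/le_trans; apply.
rewrite -mulrA ler_wpM2l// -expRD ler_expR.
by rewrite le_eqVlt; apply/orP; left; apply/eqP; lra.
Qed.

(** The interval [r, r + 1] has length 1. *)
Lemma Gamma_ge x r m : 0 < x -> 0 <= r ->
  (forall t, r <= t <= r + 1 -> m <= gamma_density x t) -> m <= Gamma x.
Proof.
move=> x0 r0 mr; have [m0|m0] := leP m 0.
  by rewrite (le_trans m0)// Rintegral_ge0// => t _; exact: gamma_density_ge0.
have i := integrable_gamma_density x0.
rewrite -lee_fin /Gamma fineK; last exact: integrable_fin_num.
apply: (@le_trans _ _ (\int[mu]_(t in `[r, (r + 1)%R]) m%:E)%E).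
  rewrite integral_cst//= lebesgue_measure_itv/= lte_fin ltrDl ltr01.
  by rewrite -EFinB addrC addKr mule1.
apply: (@le_trans _ _ (\int[mu]_(t in `[r, (r + 1)%R]) (gamma_density x t)%:E)%E).
  apply: ge0_le_integral => //.
  - by move=> t _; rewrite lee_fin ltW.
  - by apply/measurable_EFinP; apply: measurable_funTS;
      exact: measurable_gamma_density.
apply: ge0_subset_integral => //=.
- by apply/measurable_EFinP; apply: measurable_funTS;
    exact: measurable_gamma_density.
- by move=> t _; rewrite lee_fin gamma_density_ge0.
- move=> t /=; rewrite !in_itv/= andbT => /andP[rt _].
  exact: le_trans rt.
Qed.

Lemma Gamma_gt0 x : 0 < x -> 0 < Gamma x.
Proof.
move=> x0; apply: (@lt_le_trans _ _ (2^-1 * expR (- 2))).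
  by rewrite mulr_gt0 ?invr_gt0 ?expR_gt0.
apply: (@Gamma_ge _ 1) => // t /andP[t1 t2].
have t0 : 0 < t by exact: lt_le_trans t1.
apply: ler_pM; rewrite ?invr_ge0 ?expR_ge0//.
  apply: (@le_trans _ _ (t `^ (-1))).
    rewrite powR_inv1; last exact: ltW.
    by rewrite lef_pV2 ?posrE//; lra.
  by apply: ler_powR => //; lra.
by rewrite ler_expR lerN2; lra.
Qed.

(** With [r] at one's disposal, this makes the Gamma function grow faster
    than every exponential, so that the Mittag-Leffler series converges
    everywhere. *)
Lemma Gamma_lower_bound y r : 0 <= y -> 0 < r ->
  r `^ y * expR (- (r + 1)) <= Gamma (y + 1).
Proof.
move=> y0 r0; apply: (@Gamma_ge _ r); [lra|exact: ltW|].
move=> t /andP[rt tr]; have t0 : 0 < t by exact: lt_le_trans rt.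
rewrite /gamma_density addrK.
apply: ler_pM; rewrite ?powR_ge0 ?expR_ge0//.
  by rewrite ge0_ler_powR// nnegrE ltW.
by rewrite ler_expR lerN2.
Qed.

Lemma Gamma1 : Gamma (1 : R) = 1.
Proof.
have := @integral_exponential_pdf R 1 ltr01.
rewrite exponential_pdfZ => H.
rewrite /Gamma Rintegral_mkcond /Rintegral.
rewrite -[RHS]/(fine 1%:E) -H; congr fine; apply: eq_integral => t _.
congr EFin; rewrite !patchE; case: ifP => // _.
by rewrite subrr powRr0 !mul1r.
Qed.

End gamma.

(** * The semigroup of Riemann-Liouville kernels *)

Section semigroup.
Context {R : realType}.
Implicit Types (a b s t x nu : R).
Local Notation mu := (@lebesgue_measure R).
Local Notation Rpos := (`[0%R, +oo[%classic : set (measurableTypeR R)).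
Local Notation causal f := (f \_ `[0, +oo[).

Let pow nu t : R := t `^ (nu - 1).
Let beta a b := (\int[mu]_x (causal (pow a) (1 - x) * causal (pow b) x)%:E)%E.

Let measurable_causal_pow a : measurable_fun setT (causal (pow a)).
Proof.
by apply/measurable_causal; apply: measurable_funTS; exact: measurable_powR.
Qed.

Let causal_pow_ge0 a x : 0 <= causal (pow a) x.
Proof. by rewrite causalE; case: ifP => // _; exact: powR_ge0. Qed.

Let measurable_integrand a b t : measurable_fun setT
  (fun x => (causal (pow a) (t - x) * causal (pow b) x)%:E).
Proof.
apply/measurable_EFinP; apply: measurable_funM => //.
exact: measurable_reflect.
Qed.

Let integral_pow_scale a b t : 0 < t ->
  (\int[mu]_x (causal (pow a) (t - x) * causal (pow b) x)%:E =
   (t `^ (a + b - 1))%:E * beta a b)%E.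
Proof.
move=> t0.
rewrite -(ge0_integral_scale t0 (measurable_integrand a b t)); last first.
  by move=> x; rewrite lee_fin mulr_ge0.
have scaleE c x : causal (pow c) (t * x) = t `^ (c - 1) * causal (pow c) x.
  rewrite !causalE pmulr_rge0//; case: ifP => [x0|]; last by rewrite mulr0.
  by rewrite /pow powRM// ltW.
under eq_integral => x _.
  rewrite -{1}(mulr1 t) -mulrBr !scaleE mulrACA EFinM; over.
rewrite ge0_integralZl//; last 3 first.
- exact: measurable_integrand.
- by move=> x _; rewrite lee_fin mulr_ge0.
- by rewrite lee_fin mulr_ge0 ?powR_ge0.
rewrite muleA -EFinM; congr (_ %:E * _)%E.
have t0' : t != 0 by rewrite gt_eqF.
rewrite -powRD ?t0' ?implybT// -{1}(powRr1 (ltW t0)).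
rewrite -powRD ?t0' ?implybT//; congr powR; ring.
Qed.

Let integral_gamma a : 0 < a ->
  (\int[mu]_x (causal (gamma_density a) x)%:E = (Gamma a)%:E)%E.
Proof.
move=> a0; rewrite /Gamma fineK; last first.
  by apply: integrable_fin_num => //; exact: integrable_gamma_density.
by rewrite [RHS]integral_mkcond restrict_EFin.
Qed.

(** Gamma a Gamma b is the total integral of the convolution of the densities
    of Gamma a and Gamma b.  By homogeneity that convolution is, at t, the
    density of Gamma (a + b) times the beta integral. *)
Lemma Gamma_beta a b : 0 < a -> 0 < b ->
  ((Gamma (a + b))%:E * beta a b = (Gamma a * Gamma b)%:E)%E.
Proof.
move=> a0 b0; have ab0 : 0 < a + b by rewrite addr_gt0.
have mg (c : R) : measurable_fun setT (causal (gamma_density c)).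
  by apply/measurable_causal; apply: measurable_funTS;
    exact: measurable_gamma_density.
have g0 c x : 0 <= causal (gamma_density c) x.
  by rewrite causalE; case: ifP => // _; exact: gamma_density_ge0.
pose f (z : R * R) := (causal (gamma_density a) (z.1 - z.2) *
  causal (gamma_density b) z.2)%:E.
have mf : measurable_fun setT f.
  apply/measurable_EFinP; apply: measurable_funM.
    exact: measurable_sub_pair.
  by apply: measurableT_comp; [exact: mg|exact: measurable_snd].
have f0 z : (0 <= f z)%E by rewrite lee_fin mulr_ge0.
have E : (\int[mu]_y \int[mu]_x f (x, y))%E = (Gamma a * Gamma b)%:E.
  have inner y : (\int[mu]_x f (x, y) =
      (Gamma a)%:E * (causal (gamma_density b) y)%:E)%E.
    rewrite /f/=; under eq_integral do rewrite EFinM.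
    rewrite ge0_integralZr//; last 3 first.
    - apply/measurable_EFinP; apply: measurableT_comp; first exact: mg.
      exact: measurable_funB.
    - by move=> x _; rewrite lee_fin.
    - by rewrite lee_fin.
    rewrite (ge0_integral_shift (- y)
      (F := fun x => (causal (gamma_density a) x)%:E)); last 2 first.
    - by apply/measurable_EFinP; exact: mg.
    - by move=> x; rewrite lee_fin.
    by rewrite integral_gamma.
  under eq_integral do rewrite inner.
  rewrite ge0_integralZl//; last 3 first.
  - by apply/measurable_EFinP; exact: mg.
  - by move=> x _; rewrite lee_fin.
  - by rewrite lee_fin ltW// Gamma_gt0.
  by rewrite integral_gamma// EFinM.
(* Tonelli: the inner integral over x gives the product of the two Gamma
   values, the inner integral over y gives the convolution of the densities. *)
transitivity (\int[mu]_x \int[mu]_y f (x, y))%E; last first.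
  exact: (etrans (@fubini_tonelli _ _ _ _ _ mu mu f mf f0) E).
(* The convolution vanishes for t < 0; the point t = 0 is negligible. *)
clear E.
rewrite -integral_gamma// -ge0_integralZr//; last 3 first.
- by apply/measurable_EFinP; exact: mg.
- by move=> x _; rewrite lee_fin.
- by apply: integral_ge0 => x _; rewrite lee_fin mulr_ge0.
apply: ae_eq_integral => //.
- by apply: emeasurable_funM => //; by apply/measurable_EFinP; exact: mg.
- exact: measurable_fun_fubini_tonelli_F.
apply: ae_mono (@ae_neq0 R) => t t0 _.
have [tlt0|tgt0|/esym/eqP] := ltgtP t 0; last by rewrite eq_sym (negPf t0).
  rewrite causalE leNgt tlt0/= mul0e integral0_eq// => x _.
  rewrite /f/= !causalE; case: ifP => [tx|]; last by rewrite mul0r.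
  case: ifP => [x0|]; last by rewrite mulr0.
  by exfalso; move: tx; rewrite subr_ge0 => /(le_trans x0); rewrite leNgt tlt0.
transitivity (\int[mu]_x ((expR (- t))%:E *
    (causal (pow a) (t - x) * causal (pow b) x)%:E))%E; last first.
  apply: eq_integral => x _; rewrite /f/= -EFinM; congr EFin.
  rewrite !causalE; case: ifP => [_|]; last by rewrite !mul0r mulr0.
  case: ifP => [_|]; last by rewrite !mulr0.
  rewrite /gamma_density mulrACA -expRD mulrC; congr (_ * expR _); ring.
have Z := @ge0_integralZl _ _ _ mu setT measurableT _
  (measurable_integrand a b t).
rewrite [RHS]Z; last 2 first.
- by move=> x _; rewrite lee_fin mulr_ge0.
- by rewrite lee_fin expR_ge0.
rewrite integral_pow_scale// muleA -EFinM; congr (_ %:E * _)%E.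
by rewrite causalE ltW// /gamma_density mulrC.
Qed.

Definition RL_kernel nu t : R := (Gamma nu)^-1 * t `^ (nu - 1).

Lemma measurable_RL_kernel nu : measurable_fun Rpos (RL_kernel nu).
Proof.
by apply: measurable_funM => //; apply: measurable_funTS; exact: measurable_powR.
Qed.

Lemma li0_RL_kernel nu : 0 < nu -> locally_integrable0 (RL_kernel nu).
Proof. by move=> nu0; apply: li0Z; exact: li0_powR. Qed.

Lemma RL_kernel1 t : RL_kernel 1 t = 1.
Proof. by rewrite /RL_kernel Gamma1 invr1 mul1r subrr powRr0. Qed.

(** The beta integral, rescaled from [0, 1] to [0, t]. *)
Lemma convolve_RL_kernel a b t : 0 < a -> 0 < b -> 0 < t ->
  convolve (RL_kernel a) (RL_kernel b) t = RL_kernel (a + b) t.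
Proof.
move=> a0 b0 t0.
have mp c : measurable_fun Rpos (pow c).
  by apply: measurable_funTS; exact: measurable_powR.
have mk c : measurable_fun Rpos (RL_kernel c) by exact: measurable_RL_kernel.
have -> : convolve (RL_kernel a) (RL_kernel b) t =
    (Gamma b)^-1 * convolve (RL_kernel a) (pow b) t.
  exact: (convolveZr _ _ (mk a) (mp b)).
rewrite (convolveC _ (mk a) (mp b)).
have -> : convolve (pow b) (RL_kernel a) t =
    (Gamma a)^-1 * convolve (pow b) (pow a) t.
  exact: (convolveZr _ _ (mp b) (mp a)).
rewrite (convolveC _ (mp b) (mp a)) convolveE /Rintegral.
rewrite integral_pow_scale//.
have Ga (c : R) : 0 < c -> Gamma c != 0 by move=> c0; rewrite gt_eqF// Gamma_gt0.
have := Gamma_beta a0 b0; case: (beta a b) => [r| |].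
- rewrite -EFinM => -[] rE /=; rewrite /RL_kernel.
  have gab := Ga _ (addr_gt0 a0 b0).
  have -> : r = (Gamma (a + b))^-1 * (Gamma a * Gamma b) by rewrite -rE mulKf.
  move: (Ga _ a0) (Ga _ b0) gab; move: (Gamma a) (Gamma b) (Gamma (a + b)).
  move: (t `^ _) => p ga gb gab {rE}na nb nab.
  by field; rewrite nab na nb.
(* An infinite beta integral would make the product of two Gamma values
   infinite. *)
- by rewrite gt0_muley// lte_fin Gamma_gt0// addr_gt0.
- by rewrite gt0_muleNy// lte_fin Gamma_gt0// addr_gt0.
Qed.

End semigroup.

(** * Power series with infinite radius of convergence *)

Section entire_series.
Context {R : realType}.
Implicit Types (c : R^nat) (x r : R).

(** The coefficients of a power series with infinite radius of convergence. *)
Definition entire_coef c :=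
  forall r, 0 < r -> exists C, forall n, `|c n| * r ^+ n <= C.

(** The bound at twice the modulus gives domination by a geometric series of
    ratio 1/2. *)
Lemma entire_normed_cvg c x : entire_coef c ->
  cvgn [normed series (fun n => c n * x ^+ n)].
Proof.
move=> ec; pose r := 2 * (`|x| + 1).
have r0 : 0 < r by rewrite mulr_gt0 ?ltr_wpDl.
have [C cC] := ec r r0.
have C0 : 0 <= C by apply: le_trans (cC 0%N); rewrite expr0 mulr1.
have z1 : `|2^-1 : R| < 1 by rewrite ger0_norm ?invr_ge0//; lra.
have h : cvgn (series (geometric C (2^-1))) by exact: is_cvg_geometric_series.
apply: (series_le_cvg _ _ _ h) => n /=.
- exact: normr_ge0.
- by rewrite mulr_ge0 ?exprn_ge0 ?invr_ge0.
rewrite normrM normrX exprVn ler_pdivlMr ?exprn_gt0//.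
apply: le_trans (cC n); rewrite -mulrA ler_wpM2l// /r exprMn mulrC.
rewrite ler_wpM2l ?exprn_ge0// lerXn2r ?nnegrE ?addr_ge0//.
by rewrite lerDl.
Qed.

Lemma entire_diffs c : entire_coef c -> entire_coef (pseries_diffs c).
Proof.
move=> ec r r0; have r2 : 0 < 2 * r by rewrite mulr_gt0.
have [C cC] := ec _ r2.
exists (C / r) => n; rewrite ler_pdivlMr//.
apply: le_trans (cC n.+1); rewrite /pseries_diffs normrM exprMn.
rewrite ger0_norm ?ler0n// -(mulrA _ (r ^+ n)) -exprSr [X in X * _]mulrC -mulrA.
have rn : 0 <= r ^+ n.+1 by rewrite exprn_ge0// ltW.
rewrite ler_wpM2l// ler_wpM2r//.
by rewrite -natrX ler_nat ltnW// ltn_expl.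
Qed.

Lemma entire_cvg c x : entire_coef c -> cvgn (pseries c x).
Proof. by move=> ec; apply: normed_cvg; exact: entire_normed_cvg. Qed.

Lemma entire_continuous c : entire_coef c ->
  continuous (fun x => limn (pseries c x)).
Proof.
move=> ec x; have e1 := entire_diffs ec; have e2 := entire_diffs e1.
have xK : `|x| < `|(`|x| + 1)|.
  by rewrite [ltRHS]ger0_norm ?addr_ge0// ltrDl.
(* Term-by-term differentiation is applied on a disk that contains x. *)
have [dx _] := pseries_snd_diffs (@entire_cvg _ _ ec) (@entire_cvg _ _ e1)
  (@entire_cvg _ _ e2) xK.
by apply: differentiable_continuous; apply/derivable1_diffP.
Qed.

End entire_series.

(** * The Mittag-Leffler kernel and its resolvent equation *)

Section mittag_leffler_kernel.
Context {R : realType}.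
Variable (alpha : R).
Hypothesis alpha01 : 0 < alpha < 1.
Implicit Types (s t x nu : R).
Local Notation mu := (@lebesgue_measure R).
Local Notation Rpos := (`[0%R, +oo[%classic : set (measurableTypeR R)).
Local Notation k := (abc_kernel alpha).

Let alpha_gt0 : 0 < alpha. Proof. by case/andP: alpha01. Qed.

Definition ml_coef (n : nat) : R := (Gamma (alpha * n%:R + 1))^-1.

Let arg_gt0 n : 0 < alpha * n%:R + 1.
Proof. by rewrite ltr_wpDl// mulr_ge0// ltW. Qed.

Lemma ml_coef_ge0 n : 0 <= ml_coef n.
Proof. by rewrite invr_ge0 ltW// Gamma_gt0. Qed.

(** For r such that r ^ alpha is the prescribed radius, the bound
    r ^ (alpha n) e ^ (- (r + 1)) <= Gamma (alpha n + 1) suffices. *)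
Lemma ml_coef_entire : entire_coef ml_coef.
Proof.
move=> rho rho0; pose r := rho `^ alpha^-1.
have r0 : 0 < r by exact: powR_gt0.
exists (expR (r + 1)) => n; rewrite (ger0_norm (ml_coef_ge0 n)).
have y0 : 0 <= alpha * n%:R by rewrite mulr_ge0// ltW.
rewrite mulrC ler_pdivrMr ?Gamma_gt0//.
have := Gamma_lower_bound y0 r0.
rewrite expRN ler_pdivrMr ?expR_gt0// [leRHS]mulrC => H; apply: le_trans H.
rewrite /r -powRrM mulrA mulVf ?gt_eqF// mul1r powR_mulrn//.
exact: ltW.
Qed.

Lemma mittag_lefflerE x : mittag_leffler alpha x = limn (pseries ml_coef x).
Proof.
rewrite /mittag_leffler; congr (lim (series _ @ \oo)).
by apply/funext => n; rewrite mulrC.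
Qed.

Lemma continuous_mittag_leffler : continuous (mittag_leffler alpha).
Proof.
rewrite (_ : mittag_leffler alpha = fun x => limn (pseries ml_coef x)).
  exact: entire_continuous ml_coef_entire.
by apply/funext => x; exact: mittag_lefflerE.
Qed.

(** The power t ^ alpha is extended by 0 to negative t, where [powR] is 1, in order to
    get a function that is continuous on the whole line. *)
Definition causal_powR s : R := if 0 < s then s `^ alpha else 0.

Lemma causal_powRE s : 0 <= s -> causal_powR s = s `^ alpha.
Proof.
rewrite /causal_powR le_eqVlt => /predU1P[<-|->//].
by rewrite ltxx powR0// gt_eqF.
Qed.

Lemma continuous_causal_powR : continuous causal_powR.
Proof.
move=> s; have [s0|s0|->] := ltgtP s 0.
- have e : {near s, (fun=> 0) =1 causal_powR}.
    by near=> x; rewrite /causal_powR ltNge ltW//; near: x; exact: lt_nbhsl.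
  rewrite /continuous_at -(nbhs_singleton e).
  by apply: cvg_trans (near_eq_cvg e) _; exact: cvg_cst.
- have e : {near s, (fun x => x `^ alpha) =1 causal_powR}.
    by near=> x; rewrite /causal_powR ifT//; near: x; exact: lt_nbhsr.
  rewrite /continuous_at -(nbhs_singleton e).
  by apply: cvg_trans (near_eq_cvg e) _; exact: continuous_powR.
rewrite /continuous_at [causal_powR 0]/causal_powR ltxx.
apply/cvgrPdist_lt => e e0.
have d0 : 0 < e `^ alpha^-1 by exact: powR_gt0.
near=> x; rewrite sub0r normrN /causal_powR.
case: ifPn => [x0|_]; last by rewrite normr0.
rewrite ger0_norm ?powR_ge0//.
have -> : e = (e `^ alpha^-1) `^ alpha.
  by rewrite -powRrM mulVf ?gt_eqF// powRr1// ltW.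
rewrite gt0_ltr_powR// ?nnegrE ?powR_ge0// 1?ltW//.
by near: x; exact: lt_nbhsl.
Unshelve. all: by end_near. Qed.

Definition abc_kernel_ext s : R :=
  mittag_leffler alpha (- alpha / (1 - alpha) * causal_powR s).

Lemma abc_kernel_extE s : 0 <= s -> abc_kernel_ext s = k s.
Proof. by move=> s0; rewrite /abc_kernel_ext causal_powRE. Qed.

Lemma continuous_abc_kernel_ext : continuous abc_kernel_ext.
Proof.
move=> s; apply: continuous_comp; last exact: continuous_mittag_leffler.
by apply: continuousM; [exact: cvg_cst|exact: continuous_causal_powR].
Qed.

Lemma mittag_leffler0 : mittag_leffler alpha 0 = 1.
Proof.
rewrite mittag_lefflerE; apply: (cvg_lim (@Rhausdorff R)).
apply: cvg_near_cst; exists 1%N => // n /= n1.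
rewrite /pseries /series/=; case: n n1 => // n _.
rewrite big_nat_recl// big1 => [|i _]; last by rewrite exprS mul0r mulr0.
by rewrite expr0 mulr1 addr0 /ml_coef mulr0 add0r Gamma1 invr1.
Qed.

Lemma abc_kernel_ext_le0 s : s <= 0 -> abc_kernel_ext s = 1.
Proof.
by move=> s0; rewrite /abc_kernel_ext /causal_powR ltNge s0/= mulr0 mittag_leffler0.
Qed.

Lemma lb0_abc_kernel : locally_bounded0 k.
Proof.
have mk : measurable_fun setT abc_kernel_ext.
  exact: continuous_measurable_fun continuous_abc_kernel_ext.
split.
  apply: eq_measurable_fun (measurable_funTS mk) => x.
  by rewrite inE/= in_itv/= andbT => /abc_kernel_extE.
move=> T; have [T0|T0] := ltP T 0.
  exists 0; split => // x /andP[x0 xT].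
  by have := le_lt_trans (le_trans x0 xT) T0; rewrite ltxx.
have cn : {within `[0, T], continuous (fun x => `|abc_kernel_ext x|)}.
  apply: continuous_subspaceT => x; apply: continuous_comp.
    exact: continuous_abc_kernel_ext.
  exact: norm_continuous.
have [c _ cmax] := EVT_max T0 cn.
exists `|abc_kernel_ext c|; split => // x /andP[x0 xT].
by rewrite -abc_kernel_extE// cmax// in_itv/= x0 xT.
Qed.

Local Notation c := (alpha / (1 - alpha)).

Lemma lb0_RL_kernel nu : 1 <= nu -> locally_bounded0 (RL_kernel nu).
Proof.
move=> nu1; split; first exact: measurable_RL_kernel.
move=> T; exists (`|(Gamma nu)^-1| * T `^ (nu - 1)).
split; first by rewrite mulr_ge0 ?powR_ge0.
move=> x /andP[x0 xT]; rewrite normrM ler_wpM2l// ger0_norm ?powR_ge0//.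
by rewrite ge0_ler_powR ?subr_ge0 ?nnegrE// (le_trans x0).
Qed.

Let abc_partial (N : nat) x :=
  \sum_(0 <= n < N) (- c) ^+ n * RL_kernel (alpha * n%:R + 1) x.

Let abc_partialE N x : 0 <= x ->
  abc_partial N x = pseries ml_coef (- alpha / (1 - alpha) * x `^ alpha) N.
Proof.
move=> x0; apply: eq_bigr => n _; rewrite /RL_kernel -/(ml_coef n) addrK.
by rewrite /= powRrM powR_mulrn ?powR_ge0// exprMn mulNr mulrCA.
Qed.

Let lb0_partial_kernel n : locally_bounded0 (RL_kernel (alpha * n%:R + 1)).
Proof. by apply: lb0_RL_kernel; rewrite lerDr mulr_ge0// ltW. Qed.

Let lb0_abc_partial M : locally_bounded0 (abc_partial M).
Proof.
rewrite /abc_partial; elim: M => [|M IH].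
  by under eq_fun do rewrite big_nil; exact: lb0_cst.
under eq_fun do rewrite big_nat_recr//=.
by apply: lb0D => //; exact: lb0Z.
Qed.

Let convolve_abc_partial N t : 0 < t ->
  c * convolve (RL_kernel alpha) (abc_partial N) t = 1 - abc_partial N.+1 t.
Proof.
move=> t0; have -> : 1 - abc_partial N.+1 t =
    - \sum_(0 <= n < N) (- c) ^+ n.+1 * RL_kernel (alpha * n.+1%:R + 1) t.
  rewrite /abc_partial big_nat_recl// expr0 mul1r mulr0 add0r RL_kernel1.
  by rewrite opprD addrA subrr add0r.
have la := li0_RL_kernel alpha_gt0.
have lk := lb0_partial_kernel; have lp := lb0_abc_partial.
elim: N => [|N IH].
  rewrite big_nil oppr0 /convolve.
  under eq_Rintegral do rewrite /abc_partial big_nil mulr0.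
  by rewrite /Rintegral integral0 mulr0.
rewrite big_nat_recr//= opprD -IH.
have -> : abc_partial N.+1 =
    abc_partial N \+ (fun x => (- c) ^+ N * RL_kernel (alpha * N%:R + 1) x).
  by apply/funext => x; rewrite /abc_partial big_nat_recr.
rewrite convolveDr//; last exact: lb0Z.
rewrite convolveZr//; [|exact: measurable_RL_kernel..].
rewrite (convolve_RL_kernel alpha_gt0 (arg_gt0 N) t0).
rewrite mulrDr; congr (_ + _).
rewrite exprS !mulNr opprK mulrA; congr (_ * RL_kernel _ t).
by rewrite -natr1; ring.
Qed.

(** Convolution with the Riemann-Liouville kernel of order alpha maps each
    term of the Mittag-Leffler series to a multiple of the next one, so the
    identity telescopes on partial sums ([convolve_abc_partial]).  These are
    dominated on [0, t] by the sum of the absolute values of the terms at t,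
    and dominated convergence gives the limit. *)
Lemma abc_kernel_volterra t : 0 <= t ->
  k t + c * convolve (RL_kernel alpha) k t = 1.
Proof.
rewrite le_eqVlt => /predU1P[<-|t0].
  rewrite -abc_kernel_extE// abc_kernel_ext_le0// /convolve set_itv1.
  by rewrite Rintegral_set1 mulr0 addr0.
have t0' := ltW t0.
have cvgk x : 0 <= x -> abc_partial N x @[N --> \oo] --> k x.
  move=> x0; under eq_fun do rewrite abc_partialE//.
  rewrite /abc_kernel mittag_lefflerE; exact: entire_cvg ml_coef_entire.
have ca : c * convolve (RL_kernel alpha) (abc_partial N) t @[N --> \oo] -->
    c * convolve (RL_kernel alpha) k t.
  apply: cvgMl_tmp.
  pose y := - alpha / (1 - alpha) * t `^ alpha.
  pose M := limn [normed series (fun n => ml_coef n * y ^+ n)].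
  have la := li0_RL_kernel alpha_gt0.
  have := integrable_norm (integrable_convolve t la (lb0_cst M)).
  move=> ig; apply: (@Rintegral_dominated_cvg _ _ _ mu _
    (fun N x => RL_kernel alpha (t - x) * abc_partial N x) _ _ _ _ _ ig) => //.
  - move=> N; apply: measurable_convolve; first exact: measurable_RL_kernel.
    exact: lb0_measurable.
  - move=> x /=; rewrite in_itv/= => /andP[x0 _].
    by apply: cvgMl_tmp; exact: cvgk.
  move=> N x /=; rewrite in_itv/= => /andP[x0 xt].
  rewrite !normrM ler_wpM2l//.
  have nM : `|y| >= 0 by [].
  apply: le_trans (ler_norm M).
  have nd : {homo [normed series (fun n => ml_coef n * y ^+ n)] :
      n m / (n <= m)%N >-> n <= m}.
    apply/nondecreasing_seqP => n.
    by rewrite [leRHS](seriesSr (fun n => `|ml_coef n * y ^+ n|) n) lerDl.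
  have H := nondecreasing_cvgn_le nd (@entire_normed_cvg _ _ y ml_coef_entire).
  apply: le_trans (H N).
  rewrite abc_partialE// (le_trans (ler_norm_sum _ _ _))//.
  apply: ler_sum => n _ /=; rewrite normrM [leRHS]normrM !normrX ler_wpM2l//.
  rewrite lerXn2r ?nnegrE// /y normrM [leRHS]normrM ler_wpM2l//.
  rewrite !ger0_norm ?powR_ge0//.
  by rewrite ge0_ler_powR ?nnegrE// ltW.
have cb : c * convolve (RL_kernel alpha) (abc_partial N) t @[N --> \oo] -->
    1 - k t.
  under eq_fun do rewrite convolve_abc_partial//.
  apply: cvgB; first exact: cvg_cst.
  by rewrite (cvg_shiftS (fun N => abc_partial N t)); exact: cvgk.
rewrite (cvg_unique _ ca cb); last exact: Rhausdorff.
by rewrite addrCA subrr addr0.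
Qed.

End mittag_leffler_kernel.

(** * The equation and its solution in the convolution algebra *)

(* Unification would otherwise unfold iterated convolutions to integrals. *)
Local Opaque convolve.

(** [ring] treats the values of convolutions as atoms, and comparing these
    with one another up to conversion is slow; generalizing them first avoids
    the comparison. *)
Ltac convolve_ring :=
  repeat match goal with |- context [convolve ?u ?v ?t] =>
    generalize (convolve u v t); intro end;
  ring.

Section volterra_algebra.
Context {R : realType}.
Variable (alpha : R).
Hypothesis alpha01 : 0 < alpha < 1.
Implicit Types (s t x nu : R) (q : R -> R).
Local Notation mu := (@lebesgue_measure R).
Local Notation Rpos := (`[0%R, +oo[%classic : set (measurableTypeR R)).
Local Notation k := (abc_kernel alpha).
Local Notation a := (RL_kernel alpha).
Local Notation b := (RL_kernel (1 - alpha)).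
Local Notation c := (alpha / (1 - alpha)).
Local Notation "u ** v" := (convolve u v) (at level 40, left associativity).
Local Notation O := (convolve (fun=> 1)).

Let alpha_gt0 : 0 < alpha. Proof. by case/andP: alpha01. Qed.
Let alphaC_gt0 : 0 < 1 - alpha. Proof. by rewrite subr_gt0; case/andP: alpha01. Qed.
Let li0_a : locally_integrable0 a. Proof. exact: li0_RL_kernel. Qed.
Let li0_b : locally_integrable0 b. Proof. exact: li0_RL_kernel. Qed.
Let lb0_k : locally_bounded0 k. Proof. exact: lb0_abc_kernel. Qed.
Let li0_k : locally_integrable0 k. Proof. exact: lb0_li0. Qed.
Let lb0_1 : @locally_bounded0 R (fun=> 1). Proof. exact: lb0_cst. Qed.
Let li0_1 : @locally_integrable0 R (fun=> 1). Proof. exact: lb0_li0. Qed.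

(** The resolvent equation of the kernel, convolved with [q].  The kernel is
    kept as the last factor because it is locally bounded and [q] need not
    be. *)
Lemma abc_kernel_resolvent q t : locally_integrable0 q ->
  (k ** q) t + c * (a ** (q ** k)) t = O q t.
Proof.
move=> lq; have mq := li0_measurable lq.
rewrite -(convolveC _ mq lb0_1.1).
rewrite [RHS](@convolve_eqr _ _ _ (k \+ (fun x => c * (a ** k) x))); last first.
  by move=> x /andP[x0 _]; exact: (esym (abc_kernel_volterra alpha01 x0)).
have lak := lb0_convolve li0_a lb0_k.
rewrite (convolveDr t lq lb0_k (lb0Z c lak)) (convolveZr c t mq lak.1).
by rewrite (convolveC t mq lb0_k.1) (convolveCA t lq li0_a lb0_k).
Qed.

Lemma abc_resolvent q t : locally_bounded0 q ->
  c * (a ** (k ** q)) t = O q t - (k ** q) t.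
Proof.
move=> lq; rewrite -(abc_kernel_resolvent t (lb0_li0 lq)) addrAC subrr add0r.
have -> : k ** q = q ** k.
  by apply/funext => x; exact: (convolveC x lb0_k.1 lq.1).
by [].
Qed.

(** The orders alpha and 1 - alpha add up to 1, whose kernel is constant. *)
Lemma RL_kernel_inverse q t : locally_bounded0 q -> (b ** (a ** q)) t = O q t.
Proof.
move=> lq; have lba : locally_integrable0 (b ** a) by exact: li0_convolve.
rewrite (convolveA t li0_b li0_a lq) (convolveC t (li0_measurable lba) lq.1).
rewrite (convolveC t lb0_1.1 lq.1).
apply: (convolve_ae t lq.1 (li0_measurable lba) lb0_1.1); apply: aeW => x x0.
by rewrite (convolve_RL_kernel alphaC_gt0 alpha_gt0 x0) subrK RL_kernel1.
Qed.

Lemma primitiveD (u v : R -> R) t : locally_integrable0 u ->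
  locally_integrable0 v -> O (u \+ v) t = O u t + O v t.
Proof.
move=> lu lv; have mu := li0_measurable lu; have mv := li0_measurable lv.
have m1 := lb0_1.1.
rewrite (convolveC t m1 (li0_measurable (li0D lu lv))).
by rewrite (convolveDl t lu lv lb0_1) (convolveC t mu m1) (convolveC t mv m1).
Qed.

Lemma primitiveZ (u : R -> R) r t : locally_integrable0 u ->
  O (fun x => r * u x) t = r * O u t.
Proof.
by move=> lu; apply: convolveZr; [exact: lb0_1.1|exact: li0_measurable].
Qed.

Lemma primitive_convolve (u v : R -> R) t : locally_integrable0 u ->
  locally_integrable0 v -> O (u ** v) t = (u ** O v) t.
Proof.
move=> lu lv; have mu := li0_measurable lu; have mv := li0_measurable lv.
have m1 := lb0_1.1.
rewrite (convolveC t m1 (li0_measurable (li0_convolve lu lv))).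
rewrite -(convolveA t lu lv lb0_1); apply: convolve_eqr => x _.
exact: convolveC.
Qed.

(** The primitive is a convolution with the bounded function 1. *)
Lemma lb0_primitive (u : R -> R) : locally_integrable0 u ->
  locally_bounded0 (O u).
Proof.
move=> lu; rewrite (_ : O u = u ** (fun=> 1)); first exact: lb0_convolve.
apply/funext => x; apply: convolveC; first exact: lb0_1.1.
exact: li0_measurable.
Qed.

Variables (G h : R -> R) (m f0 : R).
Hypothesis li0_G : locally_integrable0 G.
Hypothesis li0_h : locally_integrable0 h.

(** The difference of the two sides of the equation for the candidate
    h + m delta with initial value [f0], after multiplication by
    (1 - alpha) / B alpha and one integration from 0.  Here [G] is the
    right-hand side multiplied by the same factor. *)
Definition abc_defect x :=
  (k ** h) x + m * k x - m - O h x - O G x - f0 * O k x.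

(** The difference between h + m delta and the claimed solution, multiplied
    by [c] and integrated once from 0. *)
Definition abc_solution_defect x :=
  c * O h x + c * m + c * O G x + (b ** G) x + f0 * O b x.

Let W x := O h x + m.
Let lb0_Oh : locally_bounded0 (O h). Proof. exact: lb0_primitive. Qed.
Let lb0_OG : locally_bounded0 (O G). Proof. exact: lb0_primitive. Qed.
Let lb0_Ob : locally_bounded0 (O b). Proof. exact: lb0_primitive. Qed.
Let lb0_Ok : locally_bounded0 (O k). Proof. exact: lb0_primitive. Qed.
Let lb0_m : locally_bounded0 (fun=> m). Proof. exact: lb0_cst. Qed.
Let lb0_W : locally_bounded0 W. Proof. exact: lb0D. Qed.
Let lb0_kh : locally_bounded0 (k ** h).
Proof.
rewrite (_ : k ** h = h ** k); first exact: lb0_convolve.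
by apply/funext => x; apply: convolveC; [exact: lb0_k.1|exact: li0_measurable].
Qed.
Let li0_bG : locally_integrable0 (b ** G). Proof. exact: li0_convolve. Qed.

Let defectE : abc_defect = ((k ** h \+ (fun x => m * k x)) \+
  (fun x => -1 * W x)) \+ ((fun x => -1 * O G x) \+ (fun x => - f0 * O k x)).
Proof. by apply/funext => x /=; rewrite /abc_defect /W; convolve_ring. Qed.

Let solution_defectE : abc_solution_defect =
  ((fun x => c * W x) \+ (fun x => c * O G x)) \+
  ((b ** G) \+ (fun x => f0 * O b x)).
Proof. by apply/funext => x /=; rewrite /abc_solution_defect /W; convolve_ring. Qed.

Lemma lb0_abc_defect : locally_bounded0 abc_defect.
Proof. by rewrite defectE; repeat (apply: lb0D || apply: lb0Z). Qed.

Lemma li0_abc_solution_defect : locally_integrable0 abc_solution_defect.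
Proof.
rewrite solution_defectE; repeat (apply: li0D || apply: li0Z) => //;
  exact: lb0_li0.
Qed.

Let li0_kh := lb0_li0 lb0_kh.
Let li0_W := lb0_li0 lb0_W.
Let li0_OG := lb0_li0 lb0_OG.
Let li0_Ob := lb0_li0 lb0_Ob.
Let li0_Ok := lb0_li0 lb0_Ok.

Let primitive_defect t : O abc_defect t =
  (k ** W) t - O W t - O (O G) t - f0 * O (O k) t.
Proof.
rewrite defectE.
have l1 := li0D li0_kh (li0Z m li0_k); have l2 := li0Z (-1) li0_W.
have l3 := li0Z (-1) li0_OG; have l4 := li0Z (- f0) li0_Ok.
rewrite (primitiveD t (li0D l1 l2) (li0D l3 l4)) (primitiveD t l1 l2).
rewrite (primitiveD t l3 l4) (primitiveD t li0_kh (li0Z m li0_k)).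
rewrite (primitiveZ m t li0_k) (primitiveZ (-1) t li0_W).
rewrite (primitiveZ (-1) t li0_OG) (primitiveZ (- f0) t li0_Ok).
rewrite (primitive_convolve t li0_k li0_h).
rewrite [(k ** W) t](convolveDr t li0_k lb0_Oh lb0_m).
have -> : (k ** (fun=> m)) t = m * O k t.
  rewrite (convolveC t lb0_1.1 lb0_k.1) -(convolveZr m t lb0_k.1 lb0_1.1).
  by apply: convolve_eqr => x _; rewrite mulr1.
convolve_ring.
Qed.

Let primitive_solution t : O abc_solution_defect t =
  c * O W t + c * O (O G) t + (b ** O G) t + f0 * O (O b) t.
Proof.
rewrite solution_defectE.
have l1 := li0Z c li0_W; have l2 := li0Z c li0_OG.
have l4 := li0Z f0 li0_Ob.
rewrite (primitiveD t (li0D l1 l2) (li0D li0_bG l4)) (primitiveD t l1 l2).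
rewrite (primitiveD t li0_bG l4) (primitiveZ c t li0_W).
rewrite (primitiveZ c t li0_OG) (primitiveZ f0 t li0_Ob).
rewrite (primitive_convolve t li0_b li0_G); convolve_ring.
Qed.

Let T q := a ** (k ** q).

Let TD q r t : locally_bounded0 q -> locally_bounded0 r ->
  T (q \+ r) t = T q t + T r t.
Proof.
move=> lq lr; rewrite /T -(convolveDr t li0_a (lb0_convolve li0_k lq)
  (lb0_convolve li0_k lr)).
by apply: convolve_eqr => x _; exact: convolveDr.
Qed.

Let TZ q s t : locally_bounded0 q -> T (fun x => s * q x) t = s * T q t.
Proof.
move=> lq; have ma := li0_measurable li0_a.
rewrite /T -(convolveZr s t ma (lb0_convolve li0_k lq).1).
by apply: convolve_eqr => x _; exact: (convolveZr _ _ lb0_k.1 lq.1).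
Qed.

Let T_b q t : locally_bounded0 q -> T (b ** q) t = O (k ** q) t.
Proof.
move=> lq; rewrite /T -(RL_kernel_inverse t (lb0_convolve li0_k lq)).
rewrite (convolveCA t li0_b li0_a (lb0_convolve li0_k lq)).
by apply: convolve_eqr => x _; exact: (convolveCA x li0_k li0_b lq).
Qed.

(** Apply q |-> a ** (k ** q) to the primitive of the solution defect, term by
    term: on the terms that carry [c] it acts by q |-> O q - k ** q
    ([abc_resolvent]), and on those that carry [b] it absorbs [b] and leaves
    O (k ** q).  The result is the double primitive of the defect of the
    equation, up to sign. *)
Lemma primitive_defects t :
  (a ** (k ** O abc_solution_defect)) t = - O (O abc_defect) t.
Proof.
have lOW := lb0_primitive li0_W; have lOOG := lb0_primitive li0_OG.
have lOOb := lb0_primitive li0_Ob; have lbOG := lb0_convolve li0_b lb0_OG.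
have lkW := lb0_convolve li0_k lb0_W; have lOOk := lb0_primitive li0_Ok.
have SE : O abc_solution_defect = ((fun x => c * O W x) \+
    (fun x => c * O (O G) x)) \+ ((b ** O G) \+ (fun x => f0 * O (O b) x)).
  by apply/funext => x; rewrite primitive_solution /= addrA.
have l1 := lb0Z c lOW; have l2 := lb0Z c lOOG; have l4 := lb0Z f0 lOOb.
have E : T (O abc_solution_defect) t =
    (c * T (O W) t + c * T (O (O G)) t) + (T (b ** O G) t + f0 * T (O (O b)) t).
  rewrite SE; apply: etrans (TD t (lb0D l1 l2) (lb0D lbOG l4)) _.
  exact: (congr2 +%R
    (etrans (TD t l1 l2) (congr2 +%R (TZ c t lOW) (TZ c t lOOG)))
    (etrans (TD t lbOG l4) (congr2 +%R erefl (TZ f0 t lOOb)))).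
have lO1 := lb0_primitive li0_1.
have Tb : T (O (O b)) t = O (O (O k)) t.
  have -> : O (O b) = b ** O (fun=> 1).
    apply/funext => x; apply: etrans _ (primitive_convolve x li0_b li0_1).
    apply: convolve_eqr => y _.
    exact: (convolveC y lb0_1.1 (li0_measurable li0_b)).
  apply: etrans (T_b t lO1) _; apply: convolve_eqr => x _.
  apply: etrans (esym (primitive_convolve x li0_k li0_1)) _.
  by apply: convolve_eqr => y _; exact: (convolveC y lb0_k.1 lb0_1.1).
have DE : O abc_defect = ((k ** W) \+ (fun x => -1 * O W x)) \+
    ((fun x => -1 * O (O G) x) \+ (fun x => - f0 * O (O k) x)).
  by apply/funext => x; rewrite primitive_defect /=; convolve_ring.
have i1 := lb0_li0 lkW; have i2 := li0Z (-1) (lb0_li0 lOW).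
have i3 := li0Z (-1) (lb0_li0 lOOG); have i4 := li0Z (- f0) (lb0_li0 lOOk).
have D : O (O abc_defect) t = ((k ** O W) t + -1 * O (O W) t) +
    (-1 * O (O (O G)) t + - f0 * O (O (O k)) t).
  rewrite DE; apply: etrans (primitiveD t (li0D i1 i2) (li0D i3 i4)) _.
  exact: (congr2 +%R
    (etrans (primitiveD t i1 i2) (congr2 +%R
      (primitive_convolve t li0_k li0_W) (primitiveZ (-1) t (lb0_li0 lOW))))
    (etrans (primitiveD t i3 i4) (congr2 +%R
      (primitiveZ (-1) t (lb0_li0 lOOG))
      (primitiveZ (- f0) t (lb0_li0 lOOk))))).
apply: (etrans E); apply: (etrans _ (congr1 -%R (esym D))).
apply: (etrans (congr2 +%R
  (congr2 +%R (abc_resolvent t lOW) (abc_resolvent t lOOG))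
  (congr2 +%R (etrans (T_b t lb0_OG) (primitive_convolve t li0_k li0_OG))
     (congr1 (fun x => f0 * x) Tb)))).
convolve_ring.
Qed.

(** All operators relating the two defects in [primitive_defects] are
    injective: the primitive by [primitive_inj], the convolutions with [a] and
    [k] by [RL_kernel_inverse] and [abc_resolvent]. *)
Lemma abc_defectP :
  {ae mu, forall x, 0 < x -> abc_defect x = 0} <->
  {ae mu, forall x, 0 < x -> abc_solution_defect x = 0}.
Proof.
have lY := lb0_li0 lb0_abc_defect; have lZ := li0_abc_solution_defect.
have m0 := (lb0_cst (0 : R)).1.
have O0 u : locally_integrable0 u -> {ae mu, forall x, 0 < x -> u x = 0} ->
    O u = fun=> 0.
  move=> lu u0; apply/funext => t.
  rewrite (convolve_ae t lb0_1.1 (li0_measurable lu) m0 u0).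
  exact: convolve_eq0.
have lOZ := lb0_primitive lZ.
split=> [Y0|Z0].
- have TOZ t : (a ** (k ** O abc_solution_defect)) t = 0.
    rewrite primitive_defects (O0 _ lY Y0) convolve_eq0 ?oppr0//.
  (* If a ** (k ** q) = 0 then O q = k ** q by the resolvent identity, and O of
     the latter is b ** (a ** (k ** q)) = 0. *)
  have KOZ : k ** O abc_solution_defect = O (O abc_solution_defect).
    apply/funext => t; have := abc_resolvent t lOZ.
    by rewrite TOZ mulr0 => /eqP; rewrite eq_sym subr_eq0 => /eqP.
  have OOO t : 0 < t -> O (O (O abc_solution_defect)) t = 0.
    move=> t0; rewrite -{1}KOZ -(RL_kernel_inverse t (lb0_convolve li0_k lOZ)).
    by apply: convolve_eq0 => x _; exact: TOZ.
  have OO := primitive_inj2 (lb0_li0 lOZ) OOO.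
  have O1 := primitive_inj2 lZ OO.
  exact: primitive_inj lZ O1.
- apply: (primitive_inj lY); apply: (primitive_inj2 lY) => t t0.
  apply: oppr_inj; rewrite -primitive_defects oppr0 (O0 _ lZ Z0).
  apply: convolve_eq0 => x _; exact: convolve_eq0.
Qed.

End volterra_algebra.
Local Transparent convolve.

(** * Smooth bump functions *)

Section bump.
Context {R : realType}.
Implicit Types (p : {poly R}) (x y s b r : R).

(** The functions p (1 / x) e ^ (- 1 / x), extended by 0.  This family is closed
    under differentiation ([flat_is_derive]), hence consists of smooth functions. *)
Definition flat p x : R := if 0 < x then p.[x^-1] * expR (- x^-1) else 0.

Lemma horner_expRN_bounded p :
  exists C : R, forall y, 0 <= y -> `|p.[y] * y ^+ 2 * expR (- y)| <= C.
Proof.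
have mono (n : nat) y : 0 <= y -> y ^+ n.+1 * expR (- y) <= n.+1`!%:R.
  move=> y0; have f0 : 0 < n.+1`!%:R :> R by rewrite ltr0n fact_gt0.
  rewrite expRN ler_pdivrMr ?expR_gt0// [leRHS]mulrC -ler_pdivrMr//.
  by apply: le_trans (expR_ge1Dxn n y0); rewrite lerDr.
exists (\sum_(i < size p) `|p`_i| * (i.+2)`!%:R) => y y0.
rewrite horner_coef !mulr_suml (le_trans (ler_norm_sum _ _ _))//.
apply: ler_sum => i _.
have -> : p`_i * y ^+ i * y ^+ 2 * expR (- y) =
    p`_i * (y ^+ i.+2 * expR (- y)) by rewrite -(addn2 i) exprD !mulrA.
rewrite normrM ler_wpM2l//.
have f0 : 0 <= y ^+ i.+2 * expR (- y).
  by rewrite mulr_ge0 ?exprn_ge0 ?expR_ge0.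
by rewrite (ger0_norm f0); exact: mono.
Qed.

(** Quadratic decay at 0 yields the derivative 0 there. *)
Lemma flat_le_sqr p : exists C : R, 0 <= C /\ forall x, `|flat p x| <= C * x ^+ 2.
Proof.
have [C pC] := horner_expRN_bounded p; exists C.
have C0 : 0 <= C by apply: le_trans (pC 0 (lexx _)).
split=> // x; rewrite /flat; case: ifPn => x0; last first.
  by rewrite normr0 mulr_ge0 ?sqr_ge0.
have y0 : 0 <= x^-1 by rewrite invr_ge0 ltW.
have x2 : 0 < x ^+ 2 by rewrite exprn_gt0.
rewrite -ler_pdivrMr//; apply: le_trans (pC _ y0).
have ix2 : 0 <= (x ^+ 2)^-1 by rewrite invr_ge0 ltW.
rewrite (_ : p.[x^-1] * x^-1 ^+ 2 * expR (- x^-1) =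
  p.[x^-1] * expR (- x^-1) * (x ^+ 2)^-1); last by rewrite exprVn mulrAC.
by rewrite [leRHS]normrM (ger0_norm ix2).
Qed.

Lemma flat_is_derive p x : is_derive x 1 (flat p) (flat ('X^2 * (p - p^`())) x).
Proof.
have [x0|x0|->] := ltgtP x 0.
- have e : {near x, cst 0 =1 flat p}.
    near=> y; rewrite /flat ltNge ltW//; near: y; exact: lt_nbhsl.
  apply: near_eq_is_derive e _; rewrite /flat ltNge (ltW x0)/=.
  exact: is_derive_cst.
- have e : {near x, (fun u => p.[u] * expR (- u)) \o GRing.inv =1 flat p}.
    near=> y; rewrite /flat ifT//; near: y; exact: lt_nbhsr.
  apply: near_eq_is_derive e _.
  have xn0 : x != 0 by rewrite gt_eqF.
  have dinv : is_derive x 1 GRing.inv (- x ^- 2).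
    by have := is_deriveV xn0 (is_derive_id x 1); rewrite scaler1.
  have dexp : is_derive x^-1 1 (fun u : R => expR (- u)) (- expR (- x^-1)).
    have := is_derive1_comp (is_derive_expR (- x^-1)) (is_deriveNid x^-1 1).
    by rewrite mulrN1.
  have dp := is_deriveM (is_derive_poly p x^-1) dexp.
  have := is_derive1_comp dp dinv.
  move=> /is_derive_eq; apply; rewrite /flat x0 !hornerE /GRing.scale/= exprVn.
  ring.
have [C [C0 pC]] := flat_le_sqr p.
have f0 q : flat q 0 = 0 by rewrite /flat ltxx.
rewrite f0.
have H : h^-1 *: ((flat p \o shift 0) (h *: 1) - flat p 0) @[h --> 0^'] --> 0.
  apply/cvgrPdist_le => e e0; near=> h.
  rewrite sub0r normrN f0 subr0 /= addr0 /GRing.scale/= mulr1 normrM normfV.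
  have hn0 : 0 < `|h| by rewrite normr_gt0; near: h; exact: nbhs_dnbhs_neq.
  rewrite mulrC ler_pdivrMr// (le_trans (pC h))//.
  rewrite -(real_normK (num_real h)) expr2 mulrA.
  rewrite ler_wpM2r//.
  have : `|h| <= e / (C + 1).
    near: h; apply: dnbhs0_le; rewrite divr_gt0// ltr_wpDl//.
  rewrite ler_pdivlMr ?ltr_wpDl// => /(le_trans _); apply.
  by rewrite mulrC ler_wpM2l// lerDl.
apply: DeriveDef; first by apply/cvg_ex; exists 0.
exact: (cvg_lim (@Rhausdorff R) H).
Unshelve. all: by end_near. Qed.

Lemma flat_comp_is_derive p s b x :
  is_derive x 1 (fun y => flat p (s * (b - y)))
    (- s * flat ('X^2 * (p - p^`())) (s * (b - x))).
Proof.
have d : is_derive x 1 (fun y : R => s * (b - y)) (- s).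
  have := is_deriveZ s (is_deriveB (is_derive_cst b x 1) (is_derive_id x 1)).
  by move=> /is_derive_eq; apply; rewrite sub0r /GRing.scale/= mulrN1.
have := @is_derive1_comp _ (flat p) (fun y => s * (b - y)) x _ _
  (flat_is_derive p _) d.
by move=> /is_derive_eq; apply; rewrite mulrC.
Qed.

(** e ^ (- 1 / ((n + 1) (b - x))) for x < b and 0 afterwards; smooth, with values
    in [0, 1], and increasing with [n] to the indicator of ]-oo, b[. *)
Definition bump b (n : nat) x := flat 1 (n.+1%:R * (b - x)).

Lemma bump_derive1n b n (i : nat) : exists r p,
  derive1n i (bump b n) = fun x => r * flat p (n.+1%:R * (b - x)).
Proof.
elim: i => [|i [r [p IH]]].
  by exists 1, 1; apply/funext => x; rewrite mul1r.
exists (r * - n.+1%:R), ('X^2 * (p - p^`())).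
rewrite derive1nS IH; apply/funext => x; rewrite derive1E.
have := is_deriveZ r (flat_comp_is_derive p n.+1%:R b x).
by move=> /@derive_val ->; rewrite /GRing.scale/= mulrA.
Qed.

Lemma test_function_bump b n : test_function (bump b n).
Proof.
split.
  move=> i x; have [r [p ->]] := bump_derive1n b n i.
  by have [+ _] := is_deriveZ r (flat_comp_is_derive p n.+1%:R b x).
exists b => x bx; rewrite /bump /flat ifF//.
by apply/negbTE; rewrite -leNgt mulr_ge0_le0// subr_le0.
Qed.

Lemma bump_itv b n x : 0 <= bump b n x <= 1.
Proof.
rewrite /bump /flat; case: ifPn => [x0|_]; last by rewrite lexx ler01.
rewrite hornerC mul1r expR_ge0/= expR_le1 oppr_le0 invr_ge0.
exact: ltW.
Qed.

Lemma bump_cvg b x : bump b n x @[n --> \oo] --> ((x < b)%R%:R : R).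
Proof.
rewrite /bump /flat; have [xb|xb] := ltP x b; last first.
  apply: cvg_near_cst; apply: nearW => n; rewrite ifF//.
  by apply/negbTE; rewrite -leNgt mulr_ge0_le0// subr_le0.
have xb0 : 0 < b - x by rewrite subr_gt0.
under eq_fun do rewrite mulr_gt0// hornerC mul1r invfM.
have -> : true%:R = expR (- (0 * (b - x)^-1)) :> R.
  by rewrite mul0r oppr0 expR0.
apply: continuous_cvg; first exact: continuous_expR.
by apply: cvgN; apply: cvgMl; exact: cvg_harmonic.
Qed.

End bump.

(** * Test functions and regular distributions *)

Section test_functions.
Context {R : realType}.
Implicit Types (phi : R -> R) (f w K : R -> R) (x y t M C : R).
Local Notation mu := (@lebesgue_measure R).
Local Notation Rpos := (`[0%R, +oo[%classic : set (measurableTypeR R)).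
Local Notation O := (convolve (fun=> 1)).

Lemma derive1_shift f y x : derive1 (fun x => f (x + y)) x = derive1 f (x + y).
Proof. by rewrite /derive1; under eq_fun do rewrite -addrA. Qed.

Lemma derivable_shift f y x : derivable f (x + y) 1 ->
  derivable (fun x => f (x + y)) x 1.
Proof.
rewrite /derivable; under eq_fun do rewrite /= addrA.
by under [in X in _ -> X]eq_fun do rewrite /=.
Qed.

Lemma test_derivable phi x : test_function phi -> derivable phi x 1.
Proof. by case=> /(_ 0%N x). Qed.

Lemma test_continuous phi : test_function phi -> continuous phi.
Proof.
move=> tphi x; apply: differentiable_continuous; apply/derivable1_diffP.
exact: test_derivable.
Qed.

Lemma test_measurable phi : test_function phi -> measurable_fun [set: R] phi.
Proof. by move=> /test_continuous; exact: continuous_measurable_fun. Qed.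

Lemma test_support phi : test_function phi ->
  exists M : R, 0 <= M /\ forall x, M <= x -> phi x = 0.
Proof.
move=> [_ [M phi0]]; exists (Num.max 0 M).
by split; [rewrite le_max lexx|move=> x; rewrite ge_max => /andP[_ /phi0]].
Qed.

Lemma test_derive1 phi : test_function phi -> test_function (derive1 phi).
Proof.
move=> [dphi [M phi0]]; split=> [n x|]; first by rewrite -derive1Sn.
exists (M + 1) => x Mx.
rewrite (near_eq_derive1 (g := fun=> 0)); first by rewrite derive1_cst.
near=> y; apply: phi0; apply/ltW; near: y; apply: lt_nbhsr; lra.
Unshelve. all: by end_near. Qed.

Lemma test_bounded_ge phi x0 : test_function phi ->
  exists C : R, 0 <= C /\ forall x, x0 <= x -> `|phi x| <= C.
Proof.
move=> tphi; have [M [M0 phi0]] := test_support tphi.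
pose N := Num.max x0 M.
have cn : {within `[x0, N], continuous (fun x => `|phi x|)}.
  apply: continuous_subspaceT => x; apply: continuous_comp.
    exact: test_continuous.
  exact: norm_continuous.
have x0N : x0 <= N by rewrite le_max lexx.
have [c _ cmax] := EVT_max x0N cn.
exists `|phi c|; split=> // x x0x.
have [xN|Nx] := leP x N; first by rewrite cmax// in_itv/= x0x.
by rewrite phi0 ?normr0// ltW// (le_lt_trans _ Nx)// le_max lexx orbT.
Qed.

Lemma test_lb0 phi : test_function phi -> locally_bounded0 phi.
Proof.
move=> tphi; split; first by apply: measurable_funTS; exact: test_measurable.
move=> T; have [C [C0 phiC]] := test_bounded_ge 0 tphi.
by exists C; split=> // x /andP[/phiC].
Qed.

(** The value at [phi] of the regular distribution of [w].  Like [smear] below, it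
    is a value of a convolution with the reflected test function phi (M - _),
    where M bounds the support of [phi] on the right. *)
Definition pairing w phi := \int[mu]_(x in `[0, +oo[) (w x * phi x).

(** The action on test functions of the adjoint of convolution with [K], as
    it occurs in [distribution_conv]. *)
Definition smear K phi x := \int[mu]_(y in `[0, +oo[) (K y * phi (x + y)).

Lemma Rintegral_support f T : (forall x, T < x -> f x = 0) ->
  \int[mu]_(x in `[0, +oo[) f x = \int[mu]_(x in `[0, T]) f x.
Proof.
move=> f0; rewrite [LHS]Rintegral_mkcond [RHS]Rintegral_mkcond.
apply: eq_Rintegral => x _; rewrite causalE truncE.
have [x0|] := leP 0 x; have [xT|xT] := leP x T => //=.
exact: f0.
Qed.

Lemma integrable_support f T : locally_integrable0 f ->
  (forall x, T < x -> f x = 0) -> mu.-integrable `[0, +oo[ (EFin \o f).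
Proof.
move=> lf f0; have i : mu.-integrable setT (EFin \o (f \_ `[0, T])).
  exact: integrable_trunc.
have {}i : mu.-integrable `[0, +oo[ (EFin \o (f \_ `[0, T])).
  by apply: integrableS i.
apply: eq_integrable i => // x; rewrite inE/= in_itv/= andbT => x0.
by rewrite truncE x0/=; case: ltP => // /f0 ->.
Qed.

Lemma pairing_convolve w phi M : (forall x, M <= x -> phi x = 0) ->
  pairing w phi = convolve (fun s => phi (M - s)) w M.
Proof.
move=> phi0; rewrite /pairing (Rintegral_support (T := M)).
  by apply: eq_Rintegral => x _; rewrite subKr mulrC.
by move=> x /ltW Mx; rewrite phi0// mulr0.
Qed.

Lemma smear_convolve K phi M x : (forall x, M <= x -> phi x = 0) ->
  smear K phi x = convolve (fun s => phi (M - s)) K (M - x).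
Proof.
move=> phi0; rewrite /smear (Rintegral_support (T := M - x)).
  by apply: eq_Rintegral => y _; rewrite mulrC; congr (phi _ * _); ring.
by move=> y Mxy; rewrite phi0 ?mulr0//; lra.
Qed.

Lemma lb0_reflect phi M : test_function phi ->
  locally_bounded0 (fun s => phi (M - s)).
Proof.
move=> tphi; split.
  by apply: measurable_funTS; apply: measurable_reflect; exact: test_measurable.
move=> T; have [C [C0 phiC]] := test_bounded_ge (M - T) tphi.
by exists C; split=> // x /andP[_ xT]; apply: phiC; lra.
Qed.

Lemma integrable_pairing w phi : locally_integrable0 w -> test_function phi ->
  mu.-integrable `[0, +oo[ (EFin \o (fun x => w x * phi x)).
Proof.
move=> lw tphi; have [M [M0 phi0]] := test_support tphi.
apply: (@integrable_support _ M).
  by apply: li0_mul_lb0 => //; exact: test_lb0.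
by move=> x /ltW Mx; rewrite phi0// mulr0.
Qed.

Lemma pairingD w f phi : locally_integrable0 w -> locally_integrable0 f ->
  test_function phi -> pairing (w \+ f) phi = pairing w phi + pairing f phi.
Proof.
move=> lw lf tphi; rewrite /pairing -RintegralD//; try exact: integrable_pairing.
by apply: eq_Rintegral => x _; rewrite mulrDl.
Qed.

Lemma pairingZ r w phi : locally_integrable0 w -> test_function phi ->
  pairing (fun x => r * w x) phi = r * pairing w phi.
Proof.
move=> lw tphi; rewrite /pairing -RintegralZl//; last exact: integrable_pairing.
by apply: eq_Rintegral => x _; rewrite mulrA.
Qed.

Lemma pairing_ae w f phi : measurable_fun Rpos w -> measurable_fun Rpos f ->
  test_function phi -> {ae mu, forall x, 0 < x -> w x = f x} ->
  pairing w phi = pairing f phi.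
Proof.
move=> mw mf tphi wf; have [M [M0 phi0]] := test_support tphi.
rewrite !(pairing_convolve _ phi0).
by apply: convolve_ae => //; exact: (lb0_reflect M tphi).1.
Qed.

(** In terms of the reflected test function this is associativity and
    commutativity of convolution, evaluated at M. *)
Lemma pairing_smear K w phi : locally_integrable0 K -> locally_integrable0 w ->
  test_function phi -> pairing w (smear K phi) = pairing (convolve K w) phi.
Proof.
move=> lK lw tphi; have [M [M0 phi0]] := test_support tphi.
have lphi := lb0_reflect M tphi; have mK := li0_measurable lK.
have mw := li0_measurable lw.
have lpw := li0_convolve lw lK.
have smear0 x : M <= x -> smear K phi x = 0.
  move=> Mx; transitivity (\int[mu]_(y in `[0, +oo[) (0 : R)).
    apply: eq_Rintegral => y; rewrite inE/= in_itv/= andbT => y0.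
    by rewrite phi0 ?mulr0//; lra.
  by rewrite /Rintegral integral0.
rewrite (pairing_convolve _ smear0) (pairing_convolve _ phi0).
set phiM := fun s => phi (M - s).
have -> : (fun s => smear K phi (M - s)) = convolve K phiM.
  apply/funext => s; rewrite (smear_convolve _ _ phi0) subKr.
  exact: (convolveC s lphi.1 mK).
rewrite (convolveC M (lb0_convolve lK lphi).1 mw) (convolveA M lw lK lphi).
rewrite (convolveC M (li0_measurable lpw) lphi.1).
by apply: convolve_eqr => x _; exact: (convolveC x mw mK).
Qed.

Lemma measurable_Rpos_shift phi x : test_function phi ->
  measurable_fun Rpos (fun y => phi (x + y)).
Proof.
move=> tphi; apply: measurable_funTS.
apply: (measurableT_comp (test_measurable tphi)); exact: measurable_funD.
Qed.

Lemma integrable_smear K phi x : locally_integrable0 K -> test_function phi ->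
  mu.-integrable `[0, +oo[ (EFin \o (fun y => K y * phi (x + y))).
Proof.
move=> lK tphi; have [M [M0 phi0]] := test_support tphi.
apply: (@integrable_support _ (M - x)).
  apply: li0_mul_lb0 => //; split; first exact: measurable_Rpos_shift.
  move=> T; have [C [C0 phiC]] := test_bounded_ge x tphi.
  by exists C; split=> // y /andP[y0 _]; apply: phiC; rewrite lerDl.
by move=> y Mxy; rewrite phi0 ?mulr0//; lra.
Qed.

(** Differentiation under the integral sign; a fixed bounded interval of
    integration suffices near x because the derivative of phi vanishes far
    to the right. *)
Let smear_derive K phi x : locally_integrable0 K -> test_function phi ->
  derivable (smear K phi) x 1 /\
  derive1 (smear K phi) x = smear K (derive1 phi) x.
Proof.
move=> lK tphi; have [M [M0 phi0]] := test_support tphi.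
have tphi' := test_derive1 tphi.
have [C [C0 phiC]] := test_bounded_ge (x - 1) tphi'.
have [M' [M'0 phi'0]] := test_support tphi'.
pose T := M' - (x - 1).
pose D y := `|(K \_ `[0, T]) y| * C.
have mRpos : measurable Rpos by exact: measurable_itv.
have Ix : (`]x - 1, x + 1[%classic : set R) x.
  by rewrite /= in_itv/=; apply/andP; split; lra.
have int z : (`]x - 1, x + 1[%classic : set R) z ->
    mu.-integrable Rpos (EFin \o (fun y => K y * phi (z + y))).
  by move=> _; exact: integrable_smear.
have der z y : (`]x - 1, x + 1[%classic : set R) z -> Rpos y ->
    derivable (fun z => K y * phi (z + y)) z 1.
  move=> _ _; apply: derivableM; first exact: derivable_cst.
  by apply: derivable_shift; exact: test_derivable.
have D0 y : 0 <= D y by rewrite mulr_ge0.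
have iD : mu.-integrable Rpos (EFin \o D).
  have i : mu.-integrable setT (EFin \o (K \_ `[0, T])).
    exact: integrable_trunc.
  have {}i : mu.-integrable Rpos (EFin \o (K \_ `[0, T])).
    by apply: integrableS i.
  exact: (integrableZr _ C (integrable_norm i)).
have dE z y : partial1of2 (fun z y => K y * phi (z + y)) z y =
    K y * derive1 phi (z + y).
  rewrite partial1of2E; have d : derivable (fun z => phi (z + y)) z 1.
    by apply: derivable_shift; exact: test_derivable.
  by rewrite (@deriveZ _ _ _ (fun z => phi (z + y)) (K y))// -derive1E
    derive1_shift.
have bD z y : (`]x - 1, x + 1[%classic : set R) z -> Rpos y ->
    `|partial1of2 (fun z y => K y * phi (z + y)) z y| <= D y.
  rewrite /= !in_itv/= andbT => /andP[xz zx] y0.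
  rewrite dE normrM /D truncE y0/=.
  have [yT|yT] := leP y T; first by rewrite ler_wpM2l// phiC//; lra.
  by rewrite phi'0 ?normr0 ?mulr0 ?mul0r//; move: yT; rewrite /T; lra.
have := derivable_under_integral mRpos Ix int der D0 iD bD.
have := differentiation_under_integral mRpos Ix int der D0 iD bD.
move=> e d; split; first exact: d.
rewrite /smear [LHS]e; apply: eq_Rintegral => y _; exact: dE.
Qed.

Lemma smear_derive1 K phi : locally_integrable0 K -> test_function phi ->
  derive1 (smear K phi) = smear K (derive1 phi).
Proof.
by move=> lK tphi; apply/funext => x; have [] := smear_derive x lK tphi.
Qed.

Lemma test_smear K phi : locally_integrable0 K -> test_function phi ->
  test_function (smear K phi).
Proof.
move=> lK tphi; have [M [M0 phi0]] := test_support tphi; split; last first.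
  exists M => x Mx; transitivity (\int[mu]_(y in `[0, +oo[) (0 : R)).
    apply: eq_Rintegral => y; rewrite inE/= in_itv/= andbT => y0.
    by rewrite phi0 ?mulr0//; lra.
  by rewrite /Rintegral integral0.
move=> n x; elim: n phi tphi {M M0 phi0} => [|n IH] phi tphi.
  by have [] := smear_derive x lK tphi.
by rewrite derive1Sn smear_derive1//; apply: IH; exact: test_derive1.
Qed.

(** Smearing with the constant 1 is integration up to +oo. *)
Lemma smear1_derive1 phi x : test_function phi ->
  smear (fun=> 1) (derive1 phi) x = - phi x.
Proof.
move=> tphi; have [M [M0 phi0]] := test_support tphi.
have tphi' := test_derive1 tphi.
have [M' [M'0 phi'0]] := test_support tphi'.
pose T := Num.max 1 (Num.max M M' - x).
have T0 : 0 < T by rewrite lt_max ltr01.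
have MT : M <= x + T.
  by rewrite -lerBlDl /T le_max lerD2r le_max lexx orbT.
have M'T : M' <= x + T.
  by rewrite -lerBlDl /T le_max lerD2r le_max lexx !orbT.
rewrite /smear (Rintegral_support (T := T)); last first.
  by move=> y Ty; rewrite phi'0 ?mulr0//; lra.
rewrite /Rintegral (@continuous_FTC2 _ _ (fun y => phi (y + x)))//=.
- by rewrite add0r [T + x]addrC phi0// sub0r.
- apply: continuous_subspaceT => y.
  have -> : (fun y => 1 * derive1 phi (x + y)) = derive1 phi \o (fun y => x + y).
    by apply/funext => z /=; rewrite mul1r.
  apply: continuous_comp; last exact: test_continuous.
  by apply: cvgD; [exact: cvg_cst|exact: cvg_id].
- have d y : derivable (fun y => phi (y + x)) y 1.
    by apply: derivable_shift; exact: test_derivable.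
  have cy y : {for y, continuous (fun y => phi (y + x))}.
    by apply: differentiable_continuous; apply/derivable1_diffP.
  split; first by move=> y _; exact: d.
  + by apply: cvg_at_right_filter; exact: cy.
  + by apply: cvg_at_left_filter; exact: cy.
- by move=> y _; rewrite derive1_shift mul1r addrC.
Qed.

Let lb0_1 : @locally_bounded0 R (fun=> 1). Proof. exact: lb0_cst. Qed.
Let li0_1 : @locally_integrable0 R (fun=> 1). Proof. exact: lb0_li0. Qed.

(** The derivative of the primitive of [w] in the sense of distributions. *)
Lemma pairing_primitive w phi : locally_integrable0 w -> test_function phi ->
  pairing w phi = - pairing (O w) (derive1 phi).
Proof.
move=> lw tphi; rewrite -(pairing_smear li0_1 lw (test_derive1 tphi)).
have -> : smear (fun=> 1) (derive1 phi) = fun x => -1 * phi x.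
  by apply/funext => x; rewrite smear1_derive1// mulN1r.
rewrite /pairing; under [in RHS]eq_Rintegral do rewrite mulrCA.
by rewrite RintegralZl//; [rewrite mulN1r opprK|exact: integrable_pairing].
Qed.

Lemma pairing1_derive1 phi : test_function phi ->
  pairing (fun=> 1) (derive1 phi) = - phi 0.
Proof.
move=> tphi; rewrite -(smear1_derive1 0 tphi).
by apply: eq_Rintegral => y _; rewrite add0r.
Qed.

(** A Dirac mass is the distributional derivative of a jump at 0. *)
Lemma primitive_dirac w C phi : locally_integrable0 w -> test_function phi ->
  pairing w phi + C * phi 0 =
  - pairing (fun x => O w x + C) (derive1 phi).
Proof.
move=> lw tphi; have tphi' := test_derive1 tphi.
have lOw : locally_integrable0 (O w) by exact: li0_convolve.
rewrite (pairing_primitive lw tphi).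
have -> : (fun x => O w x + C) = O w \+ (fun x => C * (fun=> 1) x).
  by apply/funext => x; rewrite mulr1.
rewrite pairingD//; last exact: li0Z.
by rewrite pairingZ// pairing1_derive1// opprD mulrN opprK.
Qed.

Lemma pairing_bump_cvg w b : locally_integrable0 w -> 0 < b ->
  pairing w (bump b n) @[n --> \oo] --> O w b.
Proof.
move=> lw b0; rewrite convolve1.
have -> : (fun n => pairing w (bump b n)) =
    (fun n => \int[mu]_(x in `[0, b]) (w x * bump b n x)).
  apply/funext => n; apply: Rintegral_support => x bx.
  rewrite /bump /flat ifF ?mulr0//; apply/negbTE.
  by rewrite -leNgt mulr_ge0_le0// subr_le0 ltW.
have iw : mu.-integrable `[0, b[ (EFin \o w).
  by apply: integrableS (lw b) => //; apply: subset_itvl; rewrite bnd_simp.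
have -> : \int[mu]_(x in `[0, b]) w x =
    \int[mu]_(x in `[0, b]) (w x * (x < b)%R%:R).
  have E x : x \in (`[0, b[ : set R)%classic -> w x = w x * (x < b)%R%:R.
    by rewrite inE/= in_itv/= => /andP[_ ->]; rewrite mulr1.
  rewrite -Rintegral_itv_bndo_bndc// -[RHS]Rintegral_itv_bndo_bndc.
    exact: eq_Rintegral.
  by apply: eq_integrable iw => // x xb; rewrite /= -E.
have iwn : mu.-integrable `[0, b] (EFin \o (fun x => `|w x|)).
  exact: (integrable_norm (lw b)).
apply: (@Rintegral_dominated_cvg _ _ _ mu _
  (fun n x => w x * bump b n x) _ _ _ _ _ iwn) => //.
- move=> n; apply: measurable_funM.
    by apply: measurable_Rpos_itv; exact: li0_measurable.
  apply: measurable_funTS; apply: test_measurable; exact: test_function_bump.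
- by move=> x _; apply: cvgMr; exact: bump_cvg.
- move=> n x _; have /andP[p0 p1] := bump_itv b n x.
  by rewrite normrM ler_piMr// ger0_norm.
Qed.

Lemma pairing_dirac_primitive w C : locally_integrable0 w ->
  (forall phi, test_function phi -> pairing w phi + C * phi 0 = 0) ->
  forall b, 0 < b -> O w b + C = 0.
Proof.
move=> lw H b b0; have c1 := pairing_bump_cvg lw b0.
have c2 : C * bump b n 0 @[n --> \oo] --> C * (0 < b)%R%:R.
  by apply: cvgMr; exact: bump_cvg.
have : pairing w (bump b n) + C * bump b n 0 @[n --> \oo] -->
    O w b + C * (0 < b)%R%:R.
  exact: cvgD.
under eq_fun do rewrite (H _ (test_function_bump b _)).
rewrite b0 mulr1 => c3.
have c0 : (fun=> 0 : R) n @[n --> \oo] --> (0 : R) by exact: cvg_cst.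
by rewrite (cvg_unique (@Rhausdorff R) c3 c0).
Qed.

Lemma pairing_dirac_eq0 w C : locally_integrable0 w ->
  (forall phi, test_function phi -> pairing w phi + C * phi 0 = 0) <->
  {ae mu, forall x, 0 < x -> O w x + C = 0}.
Proof.
move=> lw; split=> [H|H phi tphi].
- by apply: aeW => b b0; exact: (pairing_dirac_primitive lw H).
- rewrite primitive_dirac//.
  have m : measurable_fun Rpos (fun x => O w x + C).
    apply: measurable_funD => //; apply: li0_measurable; exact: li0_convolve.
  rewrite (pairing_ae m (f := fun=> 0) _ (test_derive1 tphi) H)//.
  rewrite /pairing; under eq_Rintegral do rewrite mul0r.
  by rewrite /Rintegral integral0 oppr0.
Qed.

(** Every test function is, up to sign, the derivative of a test function that
    again vanishes far to the right, namely of its own smearing with 1. *)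
Lemma pairing_derive1_eq0 w : locally_integrable0 w ->
  (forall phi, test_function phi -> pairing w (derive1 phi) = 0) <->
  {ae mu, forall x, 0 < x -> w x = 0}.
Proof.
move=> lw; split=> [H|H phi tphi].
- have H0 phi : test_function phi -> pairing w phi + 0 * phi 0 = 0.
    move=> tphi; have := H _ (test_smear li0_1 tphi).
    rewrite smear_derive1//.
    have -> : smear (fun=> 1) (derive1 phi) = fun x => -1 * phi x.
      by apply/funext => x; rewrite smear1_derive1// mulN1r.
    rewrite /pairing; under eq_Rintegral do rewrite mulrCA.
    rewrite RintegralZl//; last exact: integrable_pairing.
    by rewrite mulN1r mul0r addr0 => /eqP; rewrite oppr_eq0 => /eqP.
  apply: primitive_inj => // t t0.
  by rewrite -[LHS]addr0; exact: (pairing_dirac_primitive lw H0).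
- rewrite (pairing_ae (li0_measurable lw) (f := fun=> 0) _ (test_derive1 tphi) H)//.
  rewrite /pairing; under eq_Rintegral do rewrite mul0r.
  by rewrite /Rintegral integral0.
Qed.

End test_functions.

(** * Laplace-transformable functions *)

Section laplace.
Context {R : realType}.
Implicit Types (f g : R -> R) (s t x : R).
Local Notation mu := (@lebesgue_measure R).
Local Notation Rpos := (`[0%R, +oo[%classic : set (measurableTypeR R)).

Let damp s f t := expR (- (s * t)) * f t.

Let measurable_exp s : measurable_fun [set: R] (fun t : R => expR (s * t)).
Proof.
apply: measurableT_comp; first exact: measurable_expR.
by apply: measurable_funM => //.
Qed.

Let undamp s f t : f t = expR (s * t) * damp s f t.
Proof. by rewrite /damp mulrA -expRD subrr expR0 mul1r. Qed.

Lemma measurable_laplace f : laplace_transformable f -> measurable_fun Rpos f.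
Proof.
move=> [s /integrableP[/measurable_EFinP m _]].
rewrite (_ : f = fun t => expR (s * t) * damp s f t).
  by apply: measurable_funM => //; apply: measurable_funTS; exact: measurable_exp.
by apply/funext => t; exact: undamp.
Qed.

Lemma laplace_mono s r f : s <= r ->
  mu.-integrable `[0, +oo[ (fun t => (damp s f t)%:E) ->
  mu.-integrable `[0, +oo[ (fun t => (damp r f t)%:E).
Proof.
move=> sr i; have lf : laplace_transformable f by exists s.
apply: le_integrable i => //.
  apply/measurable_EFinP; apply: measurable_funM.
    apply: measurable_funTS; rewrite (_ : (fun t => _) = (fun t => expR (- r * t))).
      exact: measurable_exp.
    by apply/funext => t; rewrite mulNr.
  exact: measurable_laplace.
move=> t /=; rewrite in_itv/= andbT => t0; rewrite lee_fin !normrM ler_wpM2r//.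
rewrite !ger0_norm ?expR_ge0// ler_expR lerN2.
exact: ler_wpM2r.
Qed.

(** On a bounded interval the exponential weight is bounded away from 0. *)
Lemma laplace_li0 f : laplace_transformable f -> locally_integrable0 f.
Proof.
move=> lf; have mf := measurable_laplace lf; case: lf => s i T.
have : mu.-integrable `[0, T]
    (EFin \o (fun t => expR (`|s| * `|T|) * damp s f t)).
  have {}i : mu.-integrable `[0, T] (EFin \o damp s f).
    by apply: integrableS i => //; exact: subset_itvl.
  exact: (integrableZl _ _ i).
apply: le_integrable => //.
  by apply/measurable_EFinP; exact: measurable_Rpos_itv.
move=> t /=; rewrite in_itv/= => /andP[t0 tT].
rewrite lee_fin {1}(undamp s f t) normrM [leRHS]normrM ler_wpM2r//.
rewrite (ger0_norm (expR_ge0 _)) [leRHS](ger0_norm (expR_ge0 _)) ler_expR.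
rewrite (le_trans (ler_norm _))// normrM ler_wpM2l// (ger0_norm t0).
by rewrite (le_trans tT)// ler_norm.
Qed.

Lemma laplaceD f g : laplace_transformable f -> laplace_transformable g ->
  laplace_transformable (f \+ g).
Proof.
move=> [s sf] [r rg]; pose m := Num.max s r; exists m.
have i1 : mu.-integrable `[0, +oo[ (EFin \o damp m f).
  by apply: laplace_mono sf; rewrite le_max lexx.
have i2 : mu.-integrable `[0, +oo[ (EFin \o damp m g).
  by apply: laplace_mono rg; rewrite le_max lexx orbT.
have : mu.-integrable `[0, +oo[ (EFin \o (damp m f \+ damp m g)).
  exact: (integrableD _ i1 i2).
by apply: eq_integrable => // t _ /=; rewrite /damp mulrDr.
Qed.

Lemma laplaceZ c f : laplace_transformable f ->
  laplace_transformable (fun t => c * f t).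
Proof.
move=> [s i]; exists s.
have : mu.-integrable `[0, +oo[ (EFin \o (fun t => c * damp s f t)).
  exact: (integrableZl _ c i).
by apply: eq_integrable => // t _ /=; rewrite /damp mulrCA.
Qed.

Lemma laplace_ae f g : measurable_fun Rpos f ->
  {ae mu, forall x, 0 < x -> f x = g x} ->
  laplace_transformable g -> laplace_transformable f.
Proof.
move=> mf fg lg; have mg := measurable_laplace lg; case: lg => s ig.
have md h : measurable_fun Rpos h -> measurable_fun Rpos (damp s h).
  move=> mh; apply: measurable_funM => //; apply: measurable_funTS.
  rewrite (_ : (fun t => _) = (fun t => expR (- s * t))); first exact: measurable_exp.
  by apply/funext => t; rewrite mulNr.
exists s; have /integrableP[_ gfin] := ig; apply/integrableP; split.
  by apply/measurable_EFinP; exact: md.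
apply: le_lt_trans gfin; rewrite le_eqVlt; apply/orP; left; apply/eqP.
apply: ae_eq_integral => //.
- by apply/measurable_EFinP; apply: measurableT_comp => //; exact: md.
- by apply/measurable_EFinP; apply: measurableT_comp => //; exact: md.
apply: ae_mono2 fg (@ae_neq0 R) => x fg x0; rewrite /= in_itv/= andbT => x0'.
by rewrite /damp fg// lt_neqAle eq_sym x0.
Qed.

Lemma laplace_RL_kernel (nu : R) : 0 < nu -> laplace_transformable (RL_kernel nu).
Proof.
move=> nu0; apply: laplaceZ; exists 1.
apply: eq_integrable (integrable_gamma_density nu0) => // t _ /=.
by rewrite mul1r /gamma_density mulrC.
Qed.

End laplace.

(** * Continuity of convolutions with the kernel *)

Section kernel_continuity.
Context {R : realType}.
Variable (alpha : R).
Hypothesis alpha01 : 0 < alpha < 1.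
Local Notation mu := (@lebesgue_measure R).
Local Notation k := (abc_kernel alpha).

(** The extension of the kernel to negative times equals 1 there.
    Writing k = (k - 1) + 1, the first part gives an integral over a fixed
    interval whose integrand is continuous in the parameter, and the second
    part gives a primitive. *)
Lemma convolve_abc_kernel_continuous (u : R -> R) t :
  locally_integrable0 u -> 0 < t -> {for t, continuous (convolve k u)}.
Proof.
move=> lu t0; pose T := t + 1.
have xyT x y : 0 < x < T -> 0 <= y <= T -> - T <= x - y <= T.
  by move=> /andP[? ?] /andP[? ?]; apply/andP; split; lra.
have T0 : 0 < T by rewrite addr_gt0.
have TT : - T <= T by lra.
pose kx := abc_kernel_ext alpha.
have ck : continuous kx := continuous_abc_kernel_ext alpha01.
pose f x y := (kx (x - y) - 1) * u y.
have ckn : {within `[- T, T], continuous (fun x => `|kx x - 1|)}.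
  apply: continuous_subspaceT => x; apply: cvg_norm.
  by apply: cvgB; [exact: ck|exact: cvg_cst].
have [C kmax] : exists C, forall x, x \in `[- T, T] -> `|kx x - 1| <= C.
  by have [x0 _ kmax] := EVT_max TT ckn; exists `|kx x0 - 1|.
have mk x : measurable_fun [set: R] (fun y => kx (x - y) - 1).
  apply: measurable_funB => //; apply: measurable_reflect.
  exact: continuous_measurable_fun ck.
have fC x y : (`]0, T[%classic : set R) x ->
    (`[0, T]%classic : set (measurableTypeR R)) y -> `|f x y| <= C * `|u y|.
  rewrite /= !in_itv/= => xT yT.
  by rewrite normrM ler_wpM2r// kmax// in_itv/=; exact: xyT.
have ig : mu.-integrable `[0, T] (EFin \o (fun y => C * `|u y|)).
  exact: (integrableZl _ C (integrable_norm (lu T))).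
have mT : measurable (`[0, T]%classic : set (measurableTypeR R)).
  exact: measurable_itv.
have iff x : (`]0, T[%classic : set R) x ->
    mu.-integrable (`[0, T]%classic : set (measurableTypeR R)) (EFin \o f x).
  move=> Ix; apply: le_integrable ig => //.
    apply/measurable_EFinP; apply: measurable_funM.
      by apply: measurable_funTS; exact: mk.
    by apply: measurable_Rpos_itv; exact: li0_measurable.
  by move=> y Iy; rewrite lee_fin (le_trans (fC _ _ Ix Iy))// ler_norm.
have cf : {ae mu, forall y, (`[0, T]%classic : set (measurableTypeR R)) y ->
    {in (`]0, T[%classic : set R), continuous (f ^~ y)}}.
  apply: aeW => y _ x _; apply: cvgM; last exact: cvg_cst.
  apply: cvgB; last exact: cvg_cst.
  apply: (@continuous_comp _ _ _ (fun x => x - y) kx); last exact: ck.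
  by apply: cvgB; [exact: cvg_id|exact: cvg_cst].
have cint : {for t, continuous (fun x => \int[mu]_(y in `[0, T]) f x y)}.
  apply: (continuity_under_integral mT iff cf ig).
    by move=> x Ix; apply: aeW => y Iy; exact: fC.
  by rewrite inE/= in_itv/= t0 ltrDl ltr01.
(* For y > x the factor kx (x - y) - 1 vanishes, so the integral over [0, T]
   is the integral over [0, x]. *)
have e : {near t, (fun x => \int[mu]_(y in `[0, T]) f x y +
    convolve (fun=> 1) u x) =1 convolve k u}.
  near=> x.
  have x0' : 0 < x by near: x; exact: lt_nbhsr.
  have xT : x < T by near: x; apply: lt_nbhsl; rewrite ltrDl.
  have -> : \int[mu]_(y in `[0, T]) f x y = \int[mu]_(y in `[0, x]) f x y.
    rewrite [LHS]Rintegral_mkcond [RHS]Rintegral_mkcond.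
    apply: eq_Rintegral => y _; rewrite !truncE.
    have [y0|y0] := leP 0 y; last by rewrite !andFb.
    have [yx|yx] := leP y x; first by rewrite (le_trans yx (ltW xT)).
    rewrite andbF andTb; case: ifP => // _.
    by rewrite /f /kx abc_kernel_ext_le0 ?subrr ?mul0r// subr_le0 ltW.
  rewrite /convolve -RintegralD//.
  - apply: eq_Rintegral => y; rewrite inE/= in_itv/= => /andP[y0 yx].
    by rewrite mul1r /f mulrBl mul1r subrK /kx abc_kernel_extE// subr_ge0.
  - have Ix : (`]0, T[%classic : set R) x by rewrite /= in_itv/= x0' xT.
    apply: integrableS (iff _ Ix) => //; apply: subset_itvl.
    by rewrite bnd_simp ltW.
  - by have := lu x; apply: eq_integrable => // y _ /=; rewrite mul1r.
rewrite /prop_for /continuous_at -(nbhs_singleton e).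
apply: cvg_trans (near_eq_cvg e) _; apply: cvgD; first exact: cint.
exact: (primitive_continuous lu t0).
Unshelve. all: by end_near. Qed.

End kernel_continuity.

(** * From the equation and the formula to their defects *)

Section abc_equation.
Context {R : realType}.
Variables (alpha : R) (B : R -> R).
Hypothesis alpha01 : 0 < alpha < 1.
Hypothesis Balpha : 0 < B alpha.
Implicit Types (s t x : R) (f g h phi : R -> R).
Local Notation mu := (@lebesgue_measure R).
Local Notation Rpos := (`[0%R, +oo[%classic : set (measurableTypeR R)).
Local Notation k := (abc_kernel alpha).
Local Notation a := (RL_kernel alpha).
Local Notation b := (RL_kernel (1 - alpha)).
Local Notation c := (alpha / (1 - alpha)).
Local Notation lam := ((1 - alpha) / B alpha).
Local Notation "u ** v" := (convolve u v) (at level 40, left associativity).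
Local Notation O := (convolve (fun=> 1)).

Let alpha_gt0 : 0 < alpha. Proof. by case/andP: alpha01. Qed.
Let alphaC_gt0 : 0 < 1 - alpha. Proof. by rewrite subr_gt0; case/andP: alpha01. Qed.
Let c_gt0 : 0 < c. Proof. exact: divr_gt0. Qed.
Let lam_gt0 : 0 < lam. Proof. exact: divr_gt0. Qed.
Let li0_a : locally_integrable0 a. Proof. exact: li0_RL_kernel. Qed.
Let li0_b : locally_integrable0 b. Proof. exact: li0_RL_kernel. Qed.
Let lb0_k : locally_bounded0 k. Proof. exact: lb0_abc_kernel. Qed.
Let li0_k : locally_integrable0 k. Proof. exact: lb0_li0. Qed.
Let lb0_1 : @locally_bounded0 R (fun=> 1). Proof. exact: lb0_cst. Qed.
Let li0_1 : @locally_integrable0 R (fun=> 1). Proof. exact: lb0_li0. Qed.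

Lemma RL_integralE nu g t : measurable_fun Rpos g ->
  RL_integral nu g t = (RL_kernel nu ** g) t.
Proof.
move=> mg; have mp : measurable_fun Rpos (fun t => t `^ (nu - 1)).
  by apply: measurable_funTS; exact: measurable_powR.
rewrite /RL_integral /convolve -RintegralZl_measurable//; last first.
  exact: (@measurable_convolve _ (fun t => t `^ (nu - 1)) g t mp mg).
by apply: eq_Rintegral => x _; rewrite mulrA.
Qed.

Lemma ABC_derivativeE f t :
  ABC_derivative B alpha f t = B alpha / (1 - alpha) * (k ** derive1 f) t.
Proof.
by congr (_ * _); apply: eq_Rintegral => x _; rewrite mulrC.
Qed.

Lemma primitiveB f s t : locally_integrable0 f -> 0 <= s -> s <= t ->
  O f t - O f s = \int[mu]_(x in `[s, t]) f x.
Proof.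
move=> lf s0 st; rewrite !convolve1.
rewrite (@Rintegral_itvB _ f (BLeft 0) (BRight t) s (lf t)) ?bnd_simp//.
apply: Rintegral_itv_obnd_cbnd; apply: integrableS (lf t) => //.
by apply: subset_itvr; rewrite bnd_simp.
Qed.

Section with_data.
Variable (g : R -> R).
Hypothesis g_laplace : laplace_transformable g.
Let li0_g := laplace_li0 g_laplace.
Let mg := li0_measurable li0_g.
Local Notation G := (fun x => lam * g x).
Local Notation D := (RL_derivative alpha g).
Local Notation L := (RL_integral_at0 (1 - alpha) g).
Let li0_G : locally_integrable0 G. Proof. exact: li0Z. Qed.

(** The difference between the Riemann-Liouville integral and the primitive
    of its derivative is constant on the open half-line; as the primitive
    tends to 0 at 0, the constant is the limit of the integral there. *)
Lemma RL_integral_primitive t : RL_differentiable alpha g -> 0 < t ->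
  (b ** g) t = L + O D t.
Proof.
move=> [ac /laplace_li0 lD] t0.
pose J := RL_integral (1 - alpha) g.
have JE s : J s = (b ** g) s by exact: RL_integralE.
have step s r : 0 < s -> s <= r -> J r - O D r = J s - O D s.
  move=> s0 sr.
  have sin : (`]0%R, +oo[%classic : set R) s by rewrite /= in_itv/= s0.
  have rin : (`]0%R, +oo[%classic : set R) r.
    by rewrite /= in_itv/= (lt_le_trans s0).
  have [_] := ac s r sin rin sr; rewrite -(primitiveB lD (ltW s0) sr).
  rewrite -/J; move: (J r) (J s) (O D r) (O D s) => j1 j2 o1 o2 e.
  by rewrite -[j1](subrK j2) e; ring.
have JL s : 0 < s -> J s = (J t - O D t) + O D s.
  move=> s0; have [st|ts] := leP s t.
    by rewrite (step s t)// subrK.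
  by rewrite -(step t s) ?subrK// ltW.
have Jcvg : J s @[s --> 0^'+] --> J t - O D t.
  have e : {near 0^'+, (fun s => (J t - O D t) + O D s) =1 J}.
    near=> s; have s0 : 0 < s by near: s; exact: nbhs_right_gt.
    by rewrite (JL s s0).
  have O0 : O D s @[s --> 0^'+] --> 0.
    apply: cvg_at_right_filter.
    have := parameterized_integral_cvg_left t0 (lD t).
    rewrite (_ : parameterized_integral _ _ ^~ _ = O D)//.
    by apply/funext => x; rewrite convolve1.
  have H : J t - O D t + O D s @[s --> 0^'+] --> J t - O D t + 0.
    by apply: cvgD; [exact: cvg_cst|exact: O0].
  rewrite addr0 in H; exact: cvg_trans (near_eq_cvg e) H.
have -> : L = J t - O D t by exact: (cvg_lim (@Rhausdorff R) Jcvg).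
by rewrite subrK JE.
Unshelve. all: by end_near. Qed.

(** The claimed solution without its Dirac term.  With
    c = alpha / (1 - alpha), this grouping exhibits it as - 1 / c times a sum of
    which the primitive is the solution defect of the zero candidate, up to the
    constant coming from [RL_integral_primitive]. *)
Definition abc_solution_regular (f0 x : R) : R :=
  - c^-1 * (c * G x + lam * D x + f0 * b x).

Lemma laplace_solution_regular (f0 : R) : RL_differentiable alpha g ->
  laplace_transformable (abc_solution_regular f0).
Proof.
move=> [_ lD]; apply: laplaceZ; apply: laplaceD; first apply: laplaceD.
- by apply: laplaceZ; apply: laplaceZ.
- exact: laplaceZ.
- by apply: laplaceZ; exact: laplace_RL_kernel.
Qed.

Lemma abc_solutionE (f0 : R) phi : RL_differentiable alpha g -> test_function phi ->
  abc_solution B alpha g f0 phi =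
  pairing (abc_solution_regular f0) phi + (- c^-1 * (lam * L)) * phi 0.
Proof.
move=> [_ /laplace_li0 lD] tphi.
have lb' : locally_integrable0 (fun x => f0 * b x) by exact: li0Z.
have lD' : locally_integrable0 (fun x => lam * D x) by exact: li0Z.
have lG' : locally_integrable0 (fun x => c * G x) by exact: li0Z.
rewrite /abc_solution_regular (pairingZ _ (w := ((fun x => c * G x) \+
  (fun x => lam * D x)) \+ (fun x => f0 * b x)))//; last first.
  by apply: li0D => //; exact: li0D.
rewrite pairingD//; last exact: li0D.
rewrite pairingD// (pairingZ c li0_G tphi) (pairingZ lam li0_g tphi).
rewrite (pairingZ lam lD tphi) (pairingZ f0 li0_b tphi).
have -> : abc_solution B alpha g f0 phi =
    (alpha - 1) / B alpha * pairing g phi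
    - ((1 - alpha) ^+ 2 / (alpha * B alpha)) * pairing D phi
    - ((1 - alpha) ^+ 2 / (alpha * B alpha) * L) * phi 0
    + pairing (fun t =>
        (alpha - 1) / (alpha * Gamma (1 - alpha)) * t `^ (- alpha) * f0) phi.
  by [].
have an0 : alpha != 0 by rewrite gt_eqF.
have Gn0 : Gamma (1 - alpha) != 0 by rewrite gt_eqF// Gamma_gt0.
have -> : (fun t => (alpha - 1) / (alpha * Gamma (1 - alpha)) * t `^ (- alpha) * f0)
    = fun t => ((alpha - 1) / alpha * f0) * b t.
  apply/funext => t; rewrite /RL_kernel (_ : 1 - alpha - 1 = - alpha); last ring.
  by move: (t `^ _) (Gamma _) Gn0 => p q qn0; field; rewrite an0 qn0.
rewrite pairingZ//.
move: (pairing g phi) (pairing D phi) (pairing b phi) (phi 0) L => p1 p2 p3 p4 p5.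
have Bn0 : B alpha != 0 by rewrite gt_eqF.
have acn0 : 1 - alpha != 0 by rewrite gt_eqF.
by move: (B alpha) Bn0 => B' Bn0; field; rewrite Bn0 acn0 an0.
Qed.

(** The difference of the two distributions is a regular distribution plus
    a multiple of the Dirac mass at 0, so [pairing_dirac_eq0] applies; the
    corresponding primitive is the solution defect because
    [RL_integral_primitive] identifies the primitive of the Riemann-Liouville
    derivative. *)
Lemma solution_defectP h (m f0 : R) : RL_differentiable alpha g ->
  locally_integrable0 h ->
  (forall phi, test_function phi ->
     pairing h phi + m * phi 0 = abc_solution B alpha g f0 phi) <->
  {ae mu, forall x, 0 < x -> abc_solution_defect alpha G h m f0 x = 0}.
Proof.
move=> RLg lh; have lD := laplace_li0 RLg.2.
pose p := ((fun x => c * G x) \+ (fun x => lam * D x)) \+ (fun x => f0 * b x).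
pose w := (fun x => c * h x) \+ p.
have l1 : locally_integrable0 (fun x => c * h x) by exact: li0Z.
have l2 : locally_integrable0 (fun x => c * G x) by exact: li0Z.
have l3 : locally_integrable0 (fun x => lam * D x) by exact: li0Z.
have l4 : locally_integrable0 (fun x => f0 * b x) by exact: li0Z.
have lp : locally_integrable0 p by apply: li0D => //; exact: li0D.
have lw : locally_integrable0 w by exact: li0D.
have cn0 : c != 0 by rewrite gt_eqF.
have wE phi : test_function phi -> pairing w phi + (c * m + lam * L) * phi 0 =
    c * ((pairing h phi + m * phi 0) - abc_solution B alpha g f0 phi).
  move=> tphi; rewrite (abc_solutionE f0 RLg tphi) (pairingZ (- c^-1) lp tphi).
  rewrite (pairingD l1 lp tphi) (pairingZ c lh tphi).
  move: (pairing h phi) (pairing p phi) (phi 0) L lam => p1 p2 p3 p4 p5.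
  by move: c cn0 => c' cn0'; field.
have OwE x : 0 < x -> O w x + (c * m + lam * L) =
    abc_solution_defect alpha G h m f0 x.
  move=> x0; rewrite (primitiveD x l1 lp) (primitiveD x (li0D l2 l3) l4).
  rewrite (primitiveD x l2 l3) (primitiveZ c x lh) (primitiveZ c x li0_G).
  rewrite (primitiveZ lam x lD) (primitiveZ f0 x li0_b).
  rewrite /abc_solution_defect.
  (* The value of the Riemann-Liouville integral at 0 enters here. *)
  have -> : (b ** G) x = lam * (L + O D x).
    rewrite -(RL_integral_primitive RLg x0).
    by apply: convolveZr; exact: li0_measurable.
  convolve_ring.
split=> H.
- have /(pairing_dirac_eq0 _ lw) : forall phi, test_function phi ->
      pairing w phi + (c * m + lam * L) * phi 0 = 0.
    by move=> phi tphi; rewrite wE// H// subrr mulr0.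
  by apply: ae_mono => x + x0 => /(_ x0); rewrite OwE.
- have /(pairing_dirac_eq0 _ lw) {}H : {ae mu, forall x, 0 < x ->
      O w x + (c * m + lam * L) = 0}.
    by apply: ae_mono H => x + x0 => /(_ x0); rewrite OwE.
  move=> phi tphi; have := H phi tphi; rewrite wE//.
  by move=> /eqP; rewrite mulf_eq0 (negPf cn0)/= subr_eq0 => /eqP.
Qed.

(** Moving all operators from the test function to the distribution, the
    difference of the two sides of the equation at [phi] is a multiple of the
    pairing of the defect with the derivative of [phi]. *)
Lemma distribution_equationP h (m f0 : R) : locally_integrable0 h ->
  (forall phi, test_function phi ->
     B alpha / (1 - alpha) *
       (- (pairing h (derive1 (smear k phi)) + m * derive1 (smear k phi) 0) -
        f0 * smear k phi 0) -
     B alpha / (1 - alpha) * (pairing h phi + m * phi 0) = pairing g phi) <->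
  {ae mu, forall x, 0 < x -> abc_defect alpha G h m f0 x = 0}.
Proof.
move=> lh; have lY := lb0_li0 (lb0_abc_defect alpha01 m f0 li0_G lh).
rewrite -(pairing_derive1_eq0 lY).
have ln0 : lam != 0 by rewrite gt_eqF.
have E phi : test_function phi ->
    B alpha / (1 - alpha) *
       (- (pairing h (derive1 (smear k phi)) + m * derive1 (smear k phi) 0) -
        f0 * smear k phi 0) -
     B alpha / (1 - alpha) * (pairing h phi + m * phi 0) - pairing g phi =
    - lam^-1 * pairing (abc_defect alpha G h m f0) (derive1 phi).
  move=> tphi; have tphi' := test_derive1 tphi.
  rewrite (smear_derive1 li0_k tphi) (pairing_smear li0_k lh tphi').
  have smear0 psi : smear k psi 0 = pairing k psi.
    by apply: eq_Rintegral => y _; rewrite add0r.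
  rewrite !smear0 (pairing_primitive li0_k tphi) (primitive_dirac m lh tphi).
  rewrite (pairing_primitive li0_g tphi).
  have lkh : locally_integrable0 (k ** h) by exact: li0_convolve.
  have lOh : locally_integrable0 (O h) by exact: li0_convolve.
  have lOg : locally_integrable0 (O g) by exact: li0_convolve.
  have lOk : locally_integrable0 (O k) by exact: li0_convolve.
  have lW : locally_integrable0 (fun x => O h x + m).
    by apply: li0D => //; exact/lb0_li0/lb0_cst.
  have -> : abc_defect alpha G h m f0 = ((k ** h) \+ (fun x => m * k x)) \+
      ((fun x => -1 * (O h x + m)) \+
       ((fun x => - lam * O g x) \+ (fun x => - f0 * O k x))).
    apply/funext => x /=; rewrite /abc_defect.
    have -> : O G x = lam * O g x by exact: convolveZr lb0_1.1 mg.
    convolve_ring.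
  have l1 : locally_integrable0 (fun x => m * k x) by exact: li0Z.
  have l2 : locally_integrable0 (fun x => -1 * (O h x + m)) by exact: li0Z.
  have l3 : locally_integrable0 (fun x => - lam * O g x) by exact: li0Z.
  have l4 : locally_integrable0 (fun x => - f0 * O k x) by exact: li0Z.
  rewrite (pairingD (li0D lkh l1) (li0D l2 (li0D l3 l4)) tphi').
  rewrite (pairingD lkh l1 tphi') (pairingD l2 (li0D l3 l4) tphi').
  rewrite (pairingD l3 l4 tphi') (pairingZ m li0_k tphi').
  rewrite (pairingZ (-1) lW tphi') (pairingZ (- lam) lOg tphi').
  rewrite (pairingZ (- f0) lOk tphi').
  move: (pairing (k ** h) _) (pairing k _) (pairing (O k) _) => q1 q2 q3.
  move: (pairing (fun x => O h x + m) _) (pairing (O g) _) => q4 q5.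
  have Bn0 : B alpha != 0 by rewrite gt_eqF.
  have acn0 : 1 - alpha != 0 by rewrite gt_eqF.
  move: (B alpha) (1 - alpha) Bn0 acn0 => b1 b2 b1n b2n.
  by field; rewrite b1n b2n.
split=> H phi tphi.
- have := E phi tphi; rewrite H// subrr => /esym/eqP.
  by rewrite mulf_eq0 oppr_eq0 invr_eq0 (negPf ln0)/= => /eqP.
- by apply/eqP; rewrite -subr_eq0 E// H// mulr0.
Qed.

Section classical.
Variable (f : R -> R).
Hypothesis f_laplace : laplace_transformable f.
Hypothesis f_ac : locally_ac `[0, +oo[ f.
Let u := derive1 f.
Let li0_f := laplace_li0 f_laplace.

Let Rpos_mem x : 0 <= x -> (`[0, +oo[%classic : set R) x.
Proof. by move=> x0; rewrite /= in_itv/= x0. Qed.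

Let li0_u : locally_integrable0 u.
Proof.
move=> T; have T0 : 0 <= Num.max T 0 by rewrite le_max lexx orbT.
have [i _] := f_ac (Rpos_mem (lexx 0)) (Rpos_mem T0) T0.
apply: integrableS i => //; apply: subset_itvl.
by rewrite bnd_simp le_max lexx.
Qed.

Let fE x : 0 <= x -> f x = f 0 + O u x.
Proof.
move=> x0; have [_ e] := f_ac (Rpos_mem (lexx 0)) (Rpos_mem x0) x0.
by rewrite convolve1 -e addrCA subrr addr0.
Qed.

Let e x := (k ** u) x + (-1 * f x + -1 * G x).
Let li0_ku : locally_integrable0 (k ** u). Proof. exact: li0_convolve. Qed.
Let li0_e : locally_integrable0 e.
Proof. by apply: li0D => //; apply: li0D; exact: li0Z. Qed.

Let primitive_e x : 0 <= x -> O e x = abc_defect alpha G f 0 (f 0) x.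
Proof.
move=> x0; have l1 := li0Z (-1) li0_f; have l2 := li0Z (-1) li0_G.
rewrite (primitiveD x li0_ku (li0D l1 l2)) (primitiveD x l1 l2).
rewrite (primitiveZ (-1) x li0_f) (primitiveZ (-1) x li0_G).
rewrite (primitive_convolve x li0_k li0_u).
have -> : (k ** O u) x = (k ** (f \+ (fun y => (- f 0) * (fun=> 1) y))) x.
  apply: convolve_eqr => y /andP[y0 _] /=; rewrite fE// mulr1.
  by rewrite addrC addKr.
have lbf : locally_bounded0 f.
  split; first exact: li0_measurable li0_f.
  move=> T; have [C [C0 bC]] := (lb0D (lb0_cst (f 0)) (lb0_primitive li0_u)).2 T.
  by exists C; split=> // y yT; rewrite fE ?bC//; case/andP: yT.
rewrite (convolveDr x li0_k lbf (lb0Z (- f 0) lb0_1)).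
rewrite (convolveZr (- f 0) x lb0_k.1 lb0_1.1) (convolveC x lb0_k.1 lb0_1.1).
rewrite /abc_defect; convolve_ring.
Qed.

Let e_eq0 t :
  ABC_derivative B alpha f t - B alpha / (1 - alpha) * f t = g t <-> e t = 0.
Proof.
have ln0 : lam != 0 by rewrite gt_eqF.
have eE : e t =
    lam * (ABC_derivative B alpha f t - B alpha / (1 - alpha) * f t - g t).
  rewrite ABC_derivativeE /e; move: ((k ** _) t) (f t) (g t) => q1 q2 q3.
  have Bn0 : B alpha != 0 by rewrite gt_eqF.
  have acn0 : 1 - alpha != 0 by rewrite gt_eqF.
  move: (B alpha) (1 - alpha) Bn0 acn0 => b1 b2 b1n b2n.
  by field; rewrite b1n b2n.
split=> [h|/eqP]; first by rewrite eE h subrr mulr0.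
by rewrite eE mulf_eq0 (negPf ln0)/= subr_eq0 => /eqP.
Qed.

(** A locally absolutely continuous [f] satisfies f = f 0 + O f', hence the
    primitive of the difference of the two sides of the equation is the
    defect; a locally integrable function vanishes almost everywhere exactly
    when its primitive does. *)
Lemma classical_equationP :
  {ae mu, forall t, 0 < t ->
     ABC_derivative B alpha f t - B alpha / (1 - alpha) * f t = g t} <->
  {ae mu, forall x, 0 < x -> abc_defect alpha G f 0 (f 0) x = 0}.
Proof.
split=> H.
- have {}H : {ae mu, forall t, 0 < t -> e t = 0}.
    by apply: ae_mono H => t + t0 => /(_ t0) /e_eq0.
  apply: aeW => x x0; rewrite -primitive_e; last exact: ltW.
  rewrite (convolve_ae x lb0_1.1 (li0_measurable li0_e) (lb0_cst 0).1 H).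
  exact: convolve_eq0.
- suff : {ae mu, forall t, 0 < t -> e t = 0}.
    by apply: ae_mono => t + t0 => /(_ t0) /e_eq0.
  apply: (primitive_inj li0_e); apply: (primitive_inj2 li0_e) => t t0.
  have lOe : locally_integrable0 (O e) by exact: li0_convolve.
  have {}H : {ae mu, forall x, 0 < x -> O e x = 0}.
    by apply: ae_mono H => x + x0 => /(_ x0); rewrite primitive_e// ltW.
  rewrite (convolve_ae t lb0_1.1 (li0_measurable lOe) (lb0_cst 0).1 H).
  exact: convolve_eq0.
Qed.

(** By the equation and the resolvent identity, G = - f 0 - c a ** (f' ** k)
    almost everywhere.  Convolution with [b] turns this into the primitive of
    - f 0 b - c (k ** f'), which is continuous at positive times and, by
    the equation again, Laplace-transformable. *)
Lemma classical_RL_differentiable :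
  {ae mu, forall t, 0 < t ->
     ABC_derivative B alpha f t - B alpha / (1 - alpha) * f t = g t} ->
  RL_differentiable alpha g.
Proof.
move=> eq.
have ln0 : lam != 0 by rewrite gt_eqF.
have lq : locally_bounded0 (u ** k) by exact: lb0_convolve.
have lkq : locally_bounded0 (a ** (u ** k)) by exact: lb0_convolve.
have qE : k ** u = u ** k.
  by apply/funext => x; exact: (convolveC x lb0_k.1 (li0_measurable li0_u)).
have kuE : {ae mu, forall t, 0 < t -> G t = (k ** u) t - f t}.
  apply: ae_mono eq => t + t0 => /(_ t0) /e_eq0 e0.
  by apply/eqP; rewrite -subr_eq0 -oppr_eq0 -[X in _ == X]e0 /e; apply/eqP; convolve_ring.
pose w := (fun x => lam^-1 * (fun x => - f 0 * b x + - c * (u ** k) x) x).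
have lw1 : locally_integrable0 (fun x => - f 0 * b x) by exact: li0Z.
have lw2 : locally_integrable0 (fun x => - c * (u ** k) x).
  by apply: li0Z; exact: lb0_li0.
have lw : locally_integrable0 w by apply: li0Z; exact: li0D.
have JE : RL_integral (1 - alpha) g = O w.
  apply/funext => t; rewrite RL_integralE//.
  have bG : (b ** G) t = lam * (b ** g) t.
    by apply: convolveZr => //; exact: li0_measurable.
  have -> : (b ** g) t = lam^-1 * (b ** G) t by rewrite bG mulKf.
  rewrite (primitiveZ lam^-1 t (li0D lw1 lw2)); congr (_ * _).
  have l1 := lb0Z (- f 0) lb0_1; have l2 := lb0Z (- c) lkq.
  rewrite (convolve_ae t (f := (fun x => - f 0 * (fun=> 1) x) \+
      (fun x => - c * (a ** (u ** k)) x)) (li0_measurable li0_b)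
      (li0_measurable li0_G) (lb0D l1 l2).1); last first.
    apply: ae_mono kuE => x + x0 => /(_ x0) ->.
    rewrite (fE (ltW x0)) -(abc_kernel_resolvent alpha01 x li0_u)/= mulr1.
    convolve_ring.
  rewrite (convolveDr t li0_b l1 l2).
  rewrite (convolveZr (- f 0) t (li0_measurable li0_b) lb0_1.1).
  rewrite (convolveZr (- c) t (li0_measurable li0_b) lkq.1).
  rewrite (RL_kernel_inverse alpha01 t lq) (primitiveD t lw1 lw2).
  rewrite (primitiveZ (- f 0) t li0_b) (primitiveZ (- c) t (lb0_li0 lq)).
  by rewrite (convolveC t (li0_measurable li0_b) lb0_1.1).
have wt t : 0 < t -> {for t, continuous w}.
  move=> t0; apply: continuousM; first exact: cvg_cst.
  apply: continuousD; apply: continuousM; try exact: cvg_cst.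
    by apply: continuousM; [exact: cvg_cst|exact: continuous_powR].
  by rewrite -qE; exact: convolve_abc_kernel_continuous.
have Dw t : 0 < t -> RL_derivative alpha g t = w t.
  by move=> t0; rewrite /RL_derivative JE; have [_] := primitive_derive1 lw t0 (wt t t0).
split.
  move=> s t; rewrite /= !in_itv/= !andbT => s0 t0 st.
  have stw x : `[s, t]%classic x -> derive1 (RL_integral (1 - alpha) g) x = w x.
    by rewrite /= in_itv/= => /andP[sx _]; apply: Dw; exact: lt_le_trans sx.
  have st0 : `[s, t]%classic `<=` (`[0, t]%classic : set R).
    by apply: subset_itvr; rewrite bnd_simp ltW.
  split.
    have : mu.-integrable `[s, t] (EFin \o w) by apply: integrableS (lw t).
    by apply: eq_integrable => // x; rewrite inE => /stw /= ->.
  rewrite JE (primitiveB lw (ltW s0) st); apply: eq_Rintegral => x.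
  by rewrite inE => /stw; rewrite JE.
have mD : measurable_fun Rpos (RL_derivative alpha g).
  (* The value of the derivative at 0 is arbitrary. *)
  rewrite (_ : Rpos = [set 0] `|` `]0, +oo[%classic); last by rewrite setU1itv.

  apply/measurable_funU => //; split; first exact: measurable_fun_set1.
  apply: eq_measurable_fun (_ : measurable_fun _ w).
    by move=> x; rewrite inE/= in_itv/= andbT => /Dw ->.
  apply: measurable_funS (li0_measurable lw) => //.
  by apply: subset_itvr; rewrite bnd_simp.
apply: (laplace_ae (g := fun x =>
  lam^-1 * (fun x => - f 0 * b x + - c * (G x + f x)) x)) mD _ _.
  apply: ae_mono kuE => x + x0 => /(_ x0) Gx; rewrite Dw// /w -qE Gx.
  by rewrite subrK.
apply: laplaceZ; apply: laplaceD; first exact/laplaceZ/laplace_RL_kernel.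
by apply: laplaceZ; apply: laplaceD => //; exact: laplaceZ.
Qed.

End classical.

End with_data.
End abc_equation.

(** * Solutions of the equation *)

Theorem mainTheorem5 (R : realType) (B : R -> R)
    (B_gt0 : forall x : R, 0 <= x <= 1 -> 0 < B x) (B0 : B 0 = 1) (B1 : B 1 = 1)
    (alpha : R) (alpha01 : 0 < alpha < 1)
    (g : R -> R) (g_laplace : laplace_transformable g) :
  (* solutions that are functions, for which the integral of f' makes sense *)
  (forall f : R -> R,
     laplace_transformable f -> locally_ac `[0, +oo[ f ->
     ({ae (@lebesgue_measure R), forall t : R, 0 < t ->
         ABC_derivative B alpha f t - B alpha / (1 - alpha) * f t = g t}
      <->
      RL_differentiable alpha g /\
      same_distribution (regular_distribution f) (abc_solution B alpha g (f 0)))) /\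
  (* solutions that may contain a multiple of dirac_delta,
     with initial value f0 *)
  (RL_differentiable alpha g ->
   forall f0 : R,
     laplace_transformable_distribution (abc_solution B alpha g f0) /\
     forall f : (R -> R) -> R, laplace_transformable_distribution f ->
       (same_distribution
          (ABC_distribution_derivative B alpha f0 f
           - (B alpha / (1 - alpha)) *: f)
          (regular_distribution g)
        <->
        same_distribution f (abc_solution B alpha g f0))).
Proof.
have Balpha : 0 < B alpha.
  by apply: B_gt0; case/andP: alpha01 => /ltW -> /ltW ->.
pose G x := (1 - alpha) / B alpha * g x.
have li0_G : locally_integrable0 G by apply: li0Z; exact: laplace_li0.
split=> [f lf acf | RLg f0].
  have sol := classical_equationP alpha01 Balpha g_laplace lf acf.
  have := abc_defectP alpha01 0 (f 0) li0_G (laplace_li0 lf).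
  rewrite -/G in sol; move=> defects; split.
  - move=> eqf.
    have RLg := classical_RL_differentiable alpha01 Balpha g_laplace lf acf eqf.
    split=> // phi tphi; have {}eqf := defects.1 (sol.1 eqf).
    have := (solution_defectP alpha01 Balpha g_laplace 0 (f 0) RLg
      (laplace_li0 lf)).2 eqf phi tphi.
    by rewrite mul0r addr0.
  - move=> [RLg eqf]; apply/sol/defects.
    apply/(solution_defectP alpha01 Balpha g_laplace 0 (f 0) RLg
      (laplace_li0 lf)) => phi tphi.
    by rewrite mul0r addr0; exact: eqf.
split.
  exists (abc_solution_regular alpha B g f0).
  exists (- (alpha / (1 - alpha))^-1 *
    ((1 - alpha) / B alpha * RL_integral_at0 (1 - alpha) g)).
  split; first exact: laplace_solution_regular.
  by move=> phi tphi; rewrite (abc_solutionE alpha01 Balpha g_laplace f0 RLg tphi).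
move=> f [h [m [lh fE]]]; have li0_h := laplace_li0 lh.
have li0_k : locally_integrable0 (abc_kernel alpha).
  exact/lb0_li0/lb0_abc_kernel.
have {}fE phi : test_function phi -> f phi = pairing h phi + m * phi 0.
  by move=> /fE ->.
have eqE phi : test_function phi ->
    (ABC_distribution_derivative B alpha f0 f - (B alpha / (1 - alpha)) *: f) phi =
    B alpha / (1 - alpha) *
      (- (pairing h (derive1 (smear (abc_kernel alpha) phi)) +
          m * derive1 (smear (abc_kernel alpha) phi) 0) -
       f0 * smear (abc_kernel alpha) phi 0) -
    B alpha / (1 - alpha) * (pairing h phi + m * phi 0).
  move=> tphi; rewrite -(fE phi tphi) -fE//.
  by apply: test_derive1; exact: test_smear.
have equation := distribution_equationP alpha01 Balpha g_laplace m f0 li0_h.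
have solution := solution_defectP alpha01 Balpha g_laplace m f0 RLg li0_h.
have defects := abc_defectP alpha01 m f0 li0_G li0_h.
split=> H.
- have /equation/defects/solution {}H : forall phi, test_function phi ->
      B alpha / (1 - alpha) *
        (- (pairing h (derive1 (smear (abc_kernel alpha) phi)) +
            m * derive1 (smear (abc_kernel alpha) phi) 0) -
         f0 * smear (abc_kernel alpha) phi 0) -
      B alpha / (1 - alpha) * (pairing h phi + m * phi 0) = pairing g phi.
    by move=> phi tphi; rewrite -eqE// H.
  by move=> phi tphi; rewrite fE// H.
- have /solution/defects/equation {}H : forall phi, test_function phi ->
      pairing h phi + m * phi 0 = abc_solution B alpha g f0 phi.
    by move=> phi tphi; rewrite -fE// H.
  by move=> phi tphi; rewrite eqE// H.
Qed.
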